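(* Suppose $\psi_n$ is $M_n$-Lipschitz continuous on $\operatorname{dom}\psi_n$ and there exists $\bar z\in\operatorname{int}(\operatorname{dom}\psi_n)$ with $\mathcal A\bar z=b$. Let $\bar d:=\operatorname{dist}(\bar z,\operatorname{bd}(\operatorname{dom}\psi_n))$ (distance to the boundary), $\nabla_s:=\sup_{z\in\operatorname{dom}\psi_n}\|\nabla\psi_s(z)\|$, and let $\sigma_{\mathcal A}^+$ be the smallest positive singular value of $\mathcal A$. Then APF-IAL performs at most $$\mathcal O\left(\frac{\alpha^{3/2}\|\mathcal A\|D\sqrt{M_n+\nabla_s+\tilde\epsilon_1}}{\sqrt{\bar d\,\sigma_{\mathcal A}^+}\,(\sqrt\alpha-1)\sqrt{\hat\epsilon\hat\rho}}\right)$$ total gradient evaluations to find an $(\hat\epsilon,\hat\rho)$-approximate solution, i.e. a triple $(z,p,r)$ with $$r\in\nabla\psi_s(z)+\partial\psi_n(z)+\mathcal A^*p,\quad\|r\|\le\hat\rho,\quad\|\mathcal Az-b\|\le\hat\epsilon.$$ Hence APF-IAL performs at most $\mathcal O(1/\hat\epsilon)$ total gradient evaluations to find an $(\hat\epsilon,\hat\epsilon)$-approximate solution.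
   Context: Problem: $\min\{\psi(z):=\psi_s(z)+\psi_n(z):\mathcal Az=b\}$, where $\mathbb E$ is a finite-dimensional Euclidean space, $\mathcal A:\mathbb E\to\mathbb R^m$ is a nonzero linear map with adjoint $\mathcal A^*$, $b\in\mathbb R^m$; $\psi_s:\mathbb E\to\mathbb R$ is convex, differentiable with $\bar L$-Lipschitz gradient ($\bar L>0$); $\psi_n$ is closed proper convex with compact convex domain $\operatorname{dom}\psi_n$ of diameter $D$. $\mathcal L_c^s(z,p)=\psi_s(z)+\langle p,\mathcal Az-b\rangle+\frac c2\|\mathcal Az-b\|^2$. APF-IAL (inputs $z_0\in\operatorname{dom}\psi_n$, $p_0\in\mathbb R^m$, $(\hat\epsilon,\hat\rho)\in\mathbb R_{++}^2$, $c_1>0$, $\alpha>1$, $\omega>1$, $\tilde\epsilon_1\ge\hat\rho$): Choose $w_0\in\operatorname{dom}\psi_n$ with $w_0\ne z_0$ and $\nabla\psi_s(w_0)\neq\nabla\psi_s(z_0)$, and set $M_0=\|\nabla\psi_s(z_0)-\nabla\psi_s(w_0)\|/(4\|z_0-w_0\|)$, $D_0=\|z_0-w_0\|$ (if $\psi_s$ is affine, $M_0>0$ is arbitrary and $\bar L$ is taken large enough that $M_0\le2\bar L$). For $k=1,2,\dots$: set $\epsilon_k=\max\{\tilde\epsilon_k,\hat\rho\}$ if $\|\mathcal Az_{k-1}-b\|>\hat\epsilon$, and $\epsilon_k=\hat\rho$ otherwise; run PF-AR with pair $(\mathcal L^s_{c_k}(\cdot,p_{k-1}),\psi_n)$, initial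 point $z_{k-1}$, estimates $M_0,D_0$, tolerance $\epsilon_k$, with output $(z_k,r_k)$; set $p_k=p_{k-1}+c_k(\mathcal Az_k-b)$, $c_{k+1}=\alpha c_k$, $\tilde\epsilon_{k+1}=\tilde\epsilon_k/\omega$; stop as soon as $\|\mathcal Az_k-b\|\le\hat\epsilon$ and $\|r_k\|\le\hat\rho$, and output $(z_k,p_k,r_k)$. The subroutine PF-AR is described for a generic pair $(f,h)$, $f$ convex with $L_f$-Lipschitz gradient, $h$ closed proper convex with compact domain. Backtracking$(f,h,\sigma,x,\bar x,M_0)$: for $j=0,1,\dots$ compute $x^{++}=\arg\min_u\langle\nabla f(x),u\rangle+h(u)+\frac{\sigma}{2}\|u-\bar x\|^2+M_j\|u-x\|^2$ and $x^{+}=\arg\min_u\langle\nabla f(x),u\rangle+h(u)+M_j\|u-x\|^2$. If $f(x^{++})-f(x)-\langle\nabla f(x),x^{++}-x\rangle\le\frac{M_j}{2}\|x^{++}-x\|^2$ and $\|\nabla f(x^+)-\nabla f(x)\|\le M_j\|x^+-x\|$, return $(x^{++},x^+,M_j)$; otherwise set $M_{j+1}=2M_j$. Inner solver $\mathsf A$ (assumed available): the call $x_s=\mathsf A(f,h,\sigma_s,\bar x_s,x_{s-1})$, started at $x_{s-1}$, approximately minimizes $\phi_s(u)=f(u)+h(u)+\frac{\sigma_s}{2}\|u-\bar x_s\|^2$, whose minimizer is $x_s^*$. After its $k$-th evaluation of $\nabla f$ it has a point $x_s^k\in\operatorname{dom}h$ and an estimate $L_s^k\le c_{\mathsf A}L_f$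 ($c_{\mathsf A}$ a universal constant) with $\phi_s(x_s^k)-\phi_s(x_s^* )\le\frac{L_s^k}{k^2}\|x_{s-1}-x_s^*\|^2$. It terminates whenever $k\ge8\sqrt{2L_s^k/\sigma_s}$ and outputs $x_s=x_s^k$. AR-L$(f,h,x_0,\sigma_1,M_0)$: for $s=1,2,\dots$: if $s=1$ set $\bar x_1=x_0$; if $s\ge2$ set $\sigma_s=4\sigma_{s-1}$, $\gamma_s=1-\sigma_{s-1}/\sigma_s$, $\bar x_s=(1-\gamma_s)\bar x_{s-1}+\gamma_sx_{s-1}$. Compute $x_s=\mathsf A(f,h,\sigma_s,\bar x_s,x_{s-1})$, $(x_s^{++},x_s^+,M_s)=$ Backtracking$(f,h,\sigma_s,x_s,\bar x_s,M_{s-1})$, $v_s=2M_s(x_s-x_s^+)-\nabla f(x_s)+\nabla f(x_s^+)$. Stop as soon as $M_s\le\sigma_s$ and output $(x_s^+,v_s,M_s)$. PF-AR (inputs $(f,h)$, $x_0$, $M_0$, $D_0$, $\epsilon$): for $t=1,2,\dots$ set $D_t=4D_{t-1}$, run AR-L$(f,h,x_{t-1},\epsilon/(7D_t),M_{t-1})$ with output $(x_t,v_t,M_t)$; stop as soon as $\|v_t\|\le\epsilon$ and output $(x_t,v_t)$. Asymptotic convention: $\mathcal O(\cdot)$ is for tolerances tending to zero (say $\hat\epsilon,\hat\rho\in(0,1]$) with all other data and inputs fixed; implied constants are independent of $\hat\epsilon,\hat\rho$. *)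

(* Defs.v *)
From HB Require Import structures.
From mathcomp Require Import all_boot all_order all_algebra.
From mathcomp Require Import all_classical all_reals all_analysis.
Set Implicit Arguments.
Unset Strict Implicit.
Unset Printing Implicit Defensive.
Import Order.TTheory GRing.Theory Num.Theory numFieldNormedType.Exports.
Local Open Scope classical_set_scope.
Local Open Scope ring_scope.

(* A finite-dimensional real inner product space whose norm (and topology) is
   the one induced by the inner product [ip]. *)
HB.mixin Record NormedModule_isEuclidean (R : realType) E
    of NormedModule R E & Vector R E := {
  ip : E -> E -> R;
  ipC : forall x y, ip x y = ip y x;
  ipDl : forall x y z, ip (x + y) z = ip x z + ip y z;
  ipZl : forall a x y, ip (a *: x) y = a * ip x y;
  ip_norm : forall x, `|x| ^+ 2 = ip x x
}.

#[short(type="euclideanType")]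
HB.structure Definition Euclidean (R : realType) :=
  { E of NormedModule R E & Vector R E & NormedModule_isEuclidean R E }.

(* The library norm on ['cV[R]_m] is the sup norm, hence these two. *)
Definition dotv (R : realType) m (u v : 'cV[R]_m) : R :=
  \sum_(i < m) u i 0 * v i 0.
Definition norm2 (R : realType) m (u : 'cV[R]_m) : R := Num.sqrt (dotv u u).

Section ConvexAnalysis.
Context {R : realType} {E : euclideanType R}.
Implicit Types (f : E -> R) (h : E -> \bar R) (S : set E).

(* The Riesz representer of the differential; meaningful where [f] is
   differentiable. *)
Definition gradient f (x : E) : E :=
  get [set g : E | forall v, 'd f x v = ip g v].

Definition affine_function f := exists (g : E) (c : R), forall z, f z = ip g z + c.

Definition edom h : set E := [set x | (h x < +oo)%E].

Definition proper_efunction h := (forall x, (-oo < h x)%E) /\ edom h !=set0.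

Definition closed_efunction h :=
  closed [set xt : E * R | (h xt.1 <= xt.2%:E)%E].

Definition convex_efunction h := forall (x y : E) (t : R), 0 <= t <= 1 ->
  (h (t *: x + (1 - t) *: y)%R <= t%:E * h x + (1 - t)%R%:E * h y)%E.

Definition subdifferential h (z : E) : set E :=
  [set g | forall u, (h z + (ip g (u - z)%R)%:E <= h u)%E].

Definition is_minimizer (phi : E -> \bar R) (x : E) :=
  forall u, (phi x <= phi u)%E.

Definition argmin (phi : E -> \bar R) : E := get [set x | is_minimizer phi x].

Definition diameter S : R := sup [set `|xy.1 - xy.2| | xy in S `*` S].

Definition boundary S : set E := closure S `\` S°.

Definition dist_set (x : E) S : R := inf [set `|x - y| | y in S].

End ConvexAnalysis.

Section LinearMaps.
Context {R : realType} {E : euclideanType R} {m : nat}.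
Variable A : {linear E -> 'cV[R]_m}.

Definition adjoint (p : 'cV[R]_m) : E :=
  get [set y : E | forall z, dotv (A z) p = ip z y].

Definition opnorm : R := sup [set norm2 (A z) | z in [set z : E | `|z| <= 1]].

Definition singular_value (s : R) :=
  0 <= s /\ exists2 v : E, v != 0 & adjoint (A v) = s ^+ 2 *: v.

Definition smallest_positive_singular_value (s : R) :=
  [/\ 0 < s, singular_value s &
      forall s', 0 < s' -> singular_value s' -> s <= s'].

Definition aug_lagrangian (b : 'cV[R]_m) (psis : E -> R) (c : R)
    (p : 'cV[R]_m) (z : E) : R :=
  psis z + dotv p (A z - b) + c / 2 * norm2 (A z - b) ^+ 2.

Definition approx_solution (b : 'cV[R]_m) (psis : E -> R) (psin : E -> \bar R)
    (eh rh : R) (z : E) (p : 'cV[R]_m) (r : E) :=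
  [/\ exists2 g, subdifferential psin z g &
        r = gradient psis z + g + adjoint p,
      `|r| <= rh &
      norm2 (A z - b) <= eh].

End LinearMaps.

(* All subroutines are big-step relations "on these inputs, the run terminates
   with these outputs after [n] evaluations of the gradient".  They are
   deterministic, and a non-terminating run is related to no output. *)
Section Algorithms.
Context {R : realType} {E : euclideanType R}.

(* [A f h sigma xbar x0 k] is the point and the Lipschitz estimate that the
   inner solver has after its [k]-th gradient evaluation (1 <= k). *)
Definition solver :=
  (E -> R) -> (E -> \bar R) -> R -> E -> E -> nat -> E * R.

Definition prox_objective (f : E -> R) (h : E -> \bar R) (sigma : R)
    (xbar u : E) : \bar R :=
  ((f u)%:E + h u + (sigma / 2 * `|u - xbar| ^+ 2)%R%:E)%E.

(* The assumed accuracy of the solver on the pair [(f, h)], with [Lf] the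
   Lipschitz constant of the gradient of [f]. *)
Definition solver_guarantee (cA : R) (A : solver) (f : E -> R) (Lf : R)
    (h : E -> \bar R) :=
  forall (sigma : R) (xbar x0 xs : E) (k : nat),
  0 < sigma -> edom h xbar -> edom h x0 ->
  is_minimizer (prox_objective f h sigma xbar) xs -> (0 < k)%N ->
  let: (xk, Lk) := A f h sigma xbar x0 k in
  [/\ edom h xk,
      Lk <= cA * Lf &
      (prox_objective f h sigma xbar xk - prox_objective f h sigma xbar xs
        <= (Lk / k%:R ^+ 2 * `|x0 - xs| ^+ 2)%R%:E)%E].

Definition solver_stop (A : solver) f h (sigma : R) (xbar x0 : E) (k : nat) :=
  8 * Num.sqrt (2 * (A f h sigma xbar x0 k).2 / sigma) <= k%:R.

Definition solver_call (A : solver) f h (sigma : R) (xbar x0 : E)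
    (x : E) (n : nat) :=
  [/\ (0 < n)%N, solver_stop A f h sigma xbar x0 n,
      forall k, (0 < k < n)%N -> ~ solver_stop A f h sigma xbar x0 k &
      x = (A f h sigma xbar x0 n).1].

Section Pair.
Variables (A : solver) (f : E -> R) (h : E -> \bar R).

Definition bt_plusplus (sigma : R) (x xbar : E) (M : R) : E :=
  argmin (fun u => (ip (gradient f x) u)%:E + h u
    + (sigma / 2 * `|u - xbar| ^+ 2 + M * `|u - x| ^+ 2)%R%:E)%E.

Definition bt_plus (x : E) (M : R) : E :=
  argmin (fun u => (ip (gradient f x) u)%:E + h u + (M * `|u - x| ^+ 2)%R%:E)%E.

Definition bt_accept (sigma : R) (x xbar : E) (M : R) :=
  let xpp := bt_plusplus sigma x xbar M in
  let xp := bt_plus x M in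
  f xpp - f x - ip (gradient f x) (xpp - x) <= M / 2 * `|xpp - x| ^+ 2 /\
  `|gradient f xp - gradient f x| <= M * `|xp - x|.

(* The gradient at [x] is evaluated once, the gradient at [x^+] once per
   trial value of [M]. *)
Inductive backtracking (sigma : R) (x xbar : E) :
    R -> E -> E -> R -> nat -> Prop :=
| bt_stop M of bt_accept sigma x xbar M :
    backtracking sigma x xbar M
      (bt_plusplus sigma x xbar M) (bt_plus x M) M 2
| bt_double M xpp xp M' n of ~ bt_accept sigma x xbar M
    & backtracking sigma x xbar (2 * M) xpp xp M' n :
    backtracking sigma x xbar M xpp xp M' n.+1.

(* [ar_l_from sigma_s xbar_s x_(s-1) M_(s-1) xo vo Mo n]: AR-L entered at the
   beginning of iteration [s] outputs [(xo, vo, Mo)]. *)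
Inductive ar_l_from : R -> E -> E -> R -> E -> E -> R -> nat -> Prop :=
| ar_l_stop sigma xbar xprev Mprev x xpp xp M nA nB of
    solver_call A f h sigma xbar xprev x nA
    & backtracking sigma x xbar Mprev xpp xp M nB
    & M <= sigma :
    ar_l_from sigma xbar xprev Mprev
      xp (2 * M *: (x - xp) - gradient f x + gradient f xp) M (nA + nB)
| ar_l_next sigma xbar xprev Mprev x xpp xp M nA nB xo vo Mo n of
    solver_call A f h sigma xbar xprev x nA
    & backtracking sigma x xbar Mprev xpp xp M nB
    & sigma < M
    & (let sigma' := 4 * sigma in
       let gamma := 1 - sigma / sigma' in
       ar_l_from sigma' ((1 - gamma) *: xbar + gamma *: x) x M xo vo Mo n) :
    ar_l_from sigma xbar xprev Mprev xo vo Mo (nA + nB + n).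

Definition ar_l (x0 : E) (sigma1 M0 : R) := ar_l_from sigma1 x0 x0 M0.

(* [pf_ar_from eps x_(t-1) M_(t-1) D_(t-1) xo vo n] *)
Inductive pf_ar_from (eps : R) : E -> R -> R -> E -> E -> nat -> Prop :=
| pf_ar_stop xprev Mprev Dprev x v M n of
    ar_l xprev (eps / (7 * (4 * Dprev))) Mprev x v M n
    & `|v| <= eps :
    pf_ar_from eps xprev Mprev Dprev x v n
| pf_ar_next xprev Mprev Dprev x v M n xo vo n' of
    ar_l xprev (eps / (7 * (4 * Dprev))) Mprev x v M n
    & eps < `|v|
    & pf_ar_from eps x M (4 * Dprev) xo vo n' :
    pf_ar_from eps xprev Mprev Dprev xo vo (n + n').

Definition pf_ar (x0 : E) (M0 D0 eps : R) := pf_ar_from eps x0 M0 D0.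

End Pair.

Section APF_IAL.
Variables (slv : solver) (m : nat) (A : {linear E -> 'cV[R]_m})
  (b : 'cV[R]_m) (psis : E -> R) (psin : E -> \bar R).
Variables (M0 D0 alpha omega eh rh : R).

Definition ial_tolerance (et : R) (z : E) : R :=
  if eh < norm2 (A z - b) then Num.max et rh else rh.

Definition ial_stop (z r : E) := norm2 (A z - b) <= eh /\ `|r| <= rh.

(* [apf_ial_from z_(k-1) p_(k-1) c_k et_k z p r n] *)
Inductive apf_ial_from : E -> 'cV[R]_m -> R -> R ->
    E -> 'cV[R]_m -> E -> nat -> Prop :=
| ial_done zprev pprev c et z r n of
    pf_ar slv (aug_lagrangian A b psis c pprev) psin
      zprev M0 D0 (ial_tolerance et zprev) z r n
    & ial_stop z r :
    apf_ial_from zprev pprev c et z (pprev + c *: (A z - b)) r n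
| ial_next zprev pprev c et z r n zo po ro n' of
    pf_ar slv (aug_lagrangian A b psis c pprev) psin
      zprev M0 D0 (ial_tolerance et zprev) z r n
    & ~ ial_stop z r
    & apf_ial_from z (pprev + c *: (A z - b)) (alpha * c) (et / omega)
        zo po ro n' :
    apf_ial_from zprev pprev c et zo po ro (n + n').

End APF_IAL.

(* The two extra evaluations are those at [z0] and [w0] which define [M0]. *)
Definition apf_ial (slv : solver) m (A : {linear E -> 'cV[R]_m}) b psis psin
    (M0 D0 alpha omega c1 et1 : R) (z0 : E) (p0 : 'cV[R]_m) (eh rh : R)
    (z : E) (p : 'cV[R]_m) (r : E) (N : nat) :=
  exists2 n, N = (2 + n)%N &
    apf_ial_from slv A b psis psin M0 D0 alpha omega eh rh
      z0 p0 c1 et1 z p r n.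

Definition initial_estimates (psis : E -> R) (psin : E -> \bar R) (Lbar : R)
    (z0 w0 : E) (M0 D0 : R) :=
  [/\ edom psin w0, w0 != z0, D0 = `|z0 - w0| &
      (gradient psis w0 != gradient psis z0 /\
         M0 = `|gradient psis z0 - gradient psis w0| / (4 * `|z0 - w0|)) \/
      [/\ affine_function psis, 0 < M0 & M0 <= 2 * Lbar]].

End Algorithms.

(* Main.v *)
Require Import Defs.
From HB Require Import structures.
From mathcomp Require Import all_boot all_order all_algebra.
From mathcomp Require Import all_classical all_reals all_analysis.
From mathcomp Require Import ring lra.
Import Order.TTheory GRing.Theory Num.Theory numFieldNormedType.Exports.
Local Open Scope classical_set_scope.
Local Open Scope ring_scope.

(** The penalty parameter [c] grows geometrically, so the total cost is that of the
    last call of PF-AR up to the factor of a geometric series.  Two facts then give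
    the bound: a call with penalty [c], whose tolerance [eps] is at least [rh], costs
    [O(sqrt (c / rh))], and the last penalty is [O(1 / eh)].  The total is therefore
    [O(1 / sqrt (eh * rh))]; the other factors of the announced bound are positive
    numbers that do not depend on the tolerances.

    The last penalty.  Testing [r_k] against an interior feasible point shows that
    a multiplier can grow only while it is bounded by a fixed constant
    ([multiplier_bound]), so all the [p_k - p_0] stay in a ball of radius [B].  As
    [A z_k - b = (p_k - p_(k-1)) / c_k], every iterate with [c_k >= 2 B / eh] is
    feasible up to [eh].  The call that follows a feasible iterate has tolerance
    [rh], so it ends the run if it is feasible too.  Hence the penalty never
    exceeds [alpha ^+ 2 * (c1 + 2 * B / eh)] ([step_stuck], [apf_ial_from_spec]).

    The cost of a call.  In AR-L each stage multiplies the regularization [sigma]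
    by 4, whereas the accuracy of the inner solver divides the distance to the
    regularized minimizer by 8; together with the nonexpansiveness of proximal
    steps ([regularization_drift]) this makes
    [sigma * (|xs - xbar| + |x - xs|)] nonincreasing along the stages.  The output
    residual is at most [3 / 2] times this quantity ([residual_bound]), hence at
    most [3 sigma_1 D] ([ar_l_spec]).  With [sigma_1 = eps / (7 D_t)], PF-AR stops
    as soon as [D_t >= D], after a number of rounds that depends on neither
    tolerance ([pf_ar_spec]).  The stage costs are
    [O(sqrt (L / sigma_s))] and [sigma_s] grows by 4, so the first stage dominates;
    the doublings of the backtracking add up to a logarithm, because the estimate
    [M] is passed on and never exceeds [M0 + 4 L].
    Finally the augmented Lagrangian has smoothness constant
    [Lbar + c K ^+ 2 = O(c)], where [K] bounds the norm of [A]
    ([aug_lagrangian_smooth], [call_spec]). *)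

(** * Euclidean spaces and their linear maps *)

Section InnerProduct.
Context {R : realType} {E : euclideanType R}.
Implicit Types x y z : E.

Lemma ipDr x y z : ip x (y + z) = ip x y + ip x z.
Proof. by rewrite ipC ipDl !(ipC x). Qed.

Lemma ipZr a x y : ip x (a *: y) = a * ip x y.
Proof. by rewrite ipC ipZl (ipC x). Qed.

Lemma ipNl x y : ip (- x) y = - ip x y.
Proof. by rewrite -scaleN1r ipZl mulN1r. Qed.

Lemma ipNr x y : ip x (- y) = - ip x y.
Proof. by rewrite ipC ipNl (ipC x). Qed.

Lemma ip0l x : ip 0 x = 0.
Proof. by rewrite -(scale0r x) ipZl mul0r. Qed.

Lemma ip0r x : ip x 0 = 0.
Proof. by rewrite ipC ip0l. Qed.

Lemma ip_suml (I : Type) (r : seq I) (P : pred I) (F : I -> E) y :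
  ip (\sum_(i <- r | P i) F i) y = \sum_(i <- r | P i) ip (F i) y.
Proof.
by elim/big_ind2: _ => [|u a v b <- <-|//]; [exact: ip0l | exact: ipDl].
Qed.

Lemma ip_ge0 x : 0 <= ip x x.
Proof. by rewrite -ip_norm sqr_ge0. Qed.

Lemma ip_eq0 x : (ip x x == 0) = (x == 0).
Proof. by rewrite -ip_norm sqrf_eq0 normr_eq0. Qed.

Definition ipE := (@ipDl R E, ipDr, @ipZl R E, ipZr, ipNl, ipNr).

Lemma cauchy_schwarz x y : ip x y <= `|x| * `|y|.
Proof.
have [->|x0] := eqVneq x 0; first by rewrite ip0l normr0 mul0r.
have [->|y0] := eqVneq y 0; first by rewrite ip0r normr0 mulr0.
have xp : 0 < `|x| by rewrite normr_gt0.
have yp : 0 < `|y| by rewrite normr_gt0.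
have := ip_ge0 (`|y| *: x - `|x| *: y).
rewrite !ipE (ipC y x) -!ip_norm => h.
have : 0 <= (2 * `|x| * `|y|) * (`|x| * `|y| - ip x y) by move: h; lra.
rewrite pmulr_rge0 ?subr_ge0 //; nra.
Qed.

Lemma cauchy_schwarz_norm x y : `|ip x y| <= `|x| * `|y|.
Proof.
by rewrite ler_norml cauchy_schwarz lerNl -ipNl -(normrN x) cauchy_schwarz.
Qed.

(** The Gram matrix of a basis is invertible: a vector of coefficients in its kernel
    describes a [w] orthogonal to the whole basis, hence to itself. *)
Lemma riesz (l : E -> R) :
  (forall a u v, l (a *: u + v) = a * l u + l v) -> exists g, forall v, l v = ip g v.
Proof.
move=> llin.
have l0 : l 0 = 0.
  by have := llin 1 0 0; rewrite scale1r addr0 mul1r; lra.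
have lD u v : l (u + v) = l u + l v by rewrite -{1}(scale1r u) llin mul1r.
have lZ a u : l (a *: u) = a * l u by rewrite -(addr0 (a *: u)) llin l0 addr0.
pose e := vbasis {:E}.
pose G := \matrix_(i, j) ip e`_i e`_j : 'M[R]_(\dim {:E}).
have ebasis v : v = \sum_i coord e i v *: e`_i.
  by apply: coord_vbasis; rewrite memvf.
have Gunit : G \in unitmx.
  rewrite -row_free_unit -kermx_eq0; apply/eqP/row_matrixP => i.
  set u := row i _; have : u *m G = 0.
    by apply/sub_kermxP; exact: row_sub.
  rewrite row0 => uG; pose w := \sum_i u 0 i *: e`_i.
  have /eqP : ip w w = 0.
    rewrite {2}/w ipC ip_suml big1// => j _; rewrite ipZl.
    have -> : ip e`_j w = (u *m G) 0 j; last by rewrite uG [X in _ * X]mxE mulr0.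
    rewrite ipC ip_suml [RHS]mxE.
    by apply: eq_bigr => k _; rewrite ipZl [G _ _]mxE.
  rewrite ip_eq0 => /eqP w0; apply/rowP => j; rewrite [in RHS]mxE.
  have efree : free e by exact: (basis_free (vbasisP _)).
  by rewrite -(coord_sum_free _ _ efree) -/w w0 linear0.
pose c := (\row_j l e`_j) *m invmx G.
exists (\sum_i c 0 i *: e`_i) => v.
rewrite [in LHS](ebasis v) [in RHS](ebasis v) (big_morph l lD l0) ipC ip_suml.
apply: eq_bigr => j _; rewrite lZ ipZl; congr (_ * _).
rewrite ipC ip_suml; under eq_bigr => i _ do rewrite ipZl.
have : (c *m G) 0 j = l e`_j by rewrite /c -mulmxA mulVmx// mulmx1 mxE.
by rewrite mxE => <-; apply: eq_bigr => i _; rewrite [G _ _]mxE.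
Qed.

Lemma ip_inj x y : (forall v, ip x v = ip y v) -> x = y.
Proof.
move=> xy; apply/eqP; rewrite -subr_eq0 -ip_eq0 ipDl ipNl.
by rewrite xy subrr.
Qed.

End InnerProduct.

Section EuclideanVectors.
Context {R : realType} {m : nat}.
Implicit Types u v w : 'cV[R]_m.

Lemma dotvC u v : dotv u v = dotv v u.
Proof. by apply: eq_bigr => i _; rewrite mulrC. Qed.

Lemma dotvDl u v w : dotv (u + v) w = dotv u w + dotv v w.
Proof. by rewrite -big_split; apply: eq_bigr => i _; rewrite mxE mulrDl. Qed.

Lemma dotvZl a u v : dotv (a *: u) v = a * dotv u v.
Proof. by rewrite /dotv mulr_sumr; apply: eq_bigr => i _; rewrite mxE mulrA. Qed.

Lemma dotvDr u v w : dotv u (v + w) = dotv u v + dotv u w.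
Proof. by rewrite dotvC dotvDl !(dotvC u). Qed.

Lemma dotvZr a u v : dotv u (a *: v) = a * dotv u v.
Proof. by rewrite dotvC dotvZl (dotvC u). Qed.

Lemma dotvNl u v : dotv (- u) v = - dotv u v.
Proof. by rewrite -scaleN1r dotvZl mulN1r. Qed.

Lemma dotvNr u v : dotv u (- v) = - dotv u v.
Proof. by rewrite dotvC dotvNl (dotvC u). Qed.

Lemma dotv0 u : dotv u 0 = 0.
Proof. by rewrite -(scale0r u) dotvZr mul0r. Qed.

Definition dotvE := (dotvDl, dotvDr, dotvZl, dotvZr, dotvNl, dotvNr).

Lemma dotv_ge0 u : 0 <= dotv u u.
Proof. by apply: sumr_ge0 => i _; rewrite -expr2 sqr_ge0. Qed.

Lemma norm2_ge0 u : 0 <= norm2 u.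
Proof. exact: sqrtr_ge0. Qed.

Lemma norm2_sqr u : norm2 u ^+ 2 = dotv u u.
Proof. by rewrite /norm2 sqr_sqrtr// dotv_ge0. Qed.

Lemma norm2_eq0 u : (norm2 u == 0) = (u == 0).
Proof.
rewrite -sqrf_eq0 norm2_sqr /dotv psumr_eq0 => [|i _]; last first.
  by rewrite -expr2 sqr_ge0.
apply/allP/eqP => [h|-> i _]; last by rewrite /= mxE mul0r.
apply/colP => i; rewrite mxE; apply/eqP.
by have := h i (mem_index_enum i); rewrite /= -expr2 sqrf_eq0 => ->.
Qed.

Lemma norm20 : norm2 (0 : 'cV[R]_m) = 0.
Proof. by apply/eqP; rewrite norm2_eq0. Qed.

Lemma norm2_gt0 u : (0 < norm2 u) = (u != 0).
Proof. by rewrite lt0r norm2_ge0 norm2_eq0 andbT. Qed.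

Lemma dotv_le u v : dotv u v <= norm2 u * norm2 v.
Proof.
have [->|u0] := eqVneq u 0; first by rewrite dotvC dotv0 norm20 mul0r.
have [->|v0] := eqVneq v 0; first by rewrite dotv0 norm20 mulr0.
have := u0; have := v0; rewrite -!norm2_gt0 => vp up.
have := dotv_ge0 (norm2 v *: u - norm2 u *: v).
rewrite !dotvE (dotvC v u) -!norm2_sqr => h.
have : 0 <= (2 * norm2 u * norm2 v) * (norm2 u * norm2 v - dotv u v).
  by move: h; lra.
rewrite pmulr_rge0 ?subr_ge0 //; nra.
Qed.

Lemma norm2_triangle u v : norm2 (u + v) <= norm2 u + norm2 v.
Proof.
have := dotv_le u v; have := norm2_ge0 u; have := norm2_ge0 v.
move=> v0 u0 uv; rewrite -(ler_pXn2r (ltn0Sn 1)) ?nnegrE ?norm2_ge0 ?addr_ge0//.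
by rewrite sqrrD !norm2_sqr !dotvE (dotvC v u) mulr2n; lra.
Qed.

Lemma norm2N u : norm2 (- u) = norm2 u.
Proof. by rewrite /norm2 !dotvE opprK. Qed.

Lemma norm2Z a u : norm2 (a *: u) = `|a| * norm2 u.
Proof.
by rewrite /norm2 !dotvE mulrA -expr2 sqrtrM ?sqr_ge0// sqrtr_sqr.
Qed.

Lemma norm2_coord u i : `|u i 0| <= norm2 u.
Proof.
rewrite -(ler_pXn2r (ltn0Sn 1)) ?nnegrE ?norm2_ge0// norm2_sqr real_normK ?num_real//.
rewrite /dotv (bigD1 i)//= -expr2 lerDl; apply: sumr_ge0 => j _.
by rewrite -expr2 sqr_ge0.
Qed.

End EuclideanVectors.

Section LinearMap.
Context {R : realType} {E : euclideanType R} {m : nat}.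
Context (A : {linear E -> 'cV[R]_m}).

Lemma adjointP z p : dotv (A z) p = ip z (adjoint A p).
Proof.
have : exists g : E, forall z, dotv (A z) p = ip z g.
  have lin a u v : dotv (A (a *: u + v)) p = a * dotv (A u) p + dotv (A v) p.
    by rewrite linearP dotvDl dotvZl.
  have [g gP] := riesz _ lin.
  by exists g => v; rewrite gP ipC.
by move=> /getPex; apply.
Qed.

Lemma adjointD p q : adjoint A (p + q) = adjoint A p + adjoint A q.
Proof. by apply: ip_inj => v; rewrite ipDl !(ipC _ v) -!adjointP dotvDr. Qed.

Lemma adjointZ a p : adjoint A (a *: p) = a *: adjoint A p.
Proof. by apply: ip_inj => v; rewrite ipZl !(ipC _ v) -!adjointP dotvZr. Qed.

Lemma adjointB p q : adjoint A (p - q) = adjoint A p - adjoint A q.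
Proof. by rewrite -(scaleN1r q) adjointD adjointZ scaleN1r. Qed.

Lemma linear_norm2_bounded : exists2 K : R, 0 < K & forall z, norm2 (A z) <= K * `|z|.
Proof.
pose g i := adjoint A (delta_mx i 0).
have gP z i : A z i 0 = ip z (g i).
  rewrite -adjointP /dotv (bigD1 i)//= big1 => [|j /negbTE ji].
    by rewrite mxE !eqxx mulr1 addr0.
  by rewrite mxE ji mulr0.
pose S := \sum_(i < m) `|g i| ^+ 2.
have S0 : 0 <= S by apply: sumr_ge0 => i _; exact: sqr_ge0.
exists (Num.sqrt S + 1) => [|z]; first by rewrite ltr_wpDl ?sqrtr_ge0.
apply: (@le_trans _ _ (Num.sqrt S * `|z|)); last first.
  by rewrite ler_wpM2r// lerDl.
rewrite -(ler_pXn2r (ltn0Sn 1)) ?nnegrE ?norm2_ge0 ?mulr_ge0 ?sqrtr_ge0//.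
rewrite norm2_sqr exprMn sqr_sqrtr// /dotv /S mulr_suml; apply: ler_sum => i _.
rewrite gP -expr2 -exprMn -real_normK ?num_real//.
by rewrite ler_pXn2r ?nnegrE ?mulr_ge0// mulrC cauchy_schwarz_norm.
Qed.

Lemma adjoint_bounded (K : R) : 0 <= K -> (forall z, norm2 (A z) <= K * `|z|) ->
  forall p, `|adjoint A p| <= K * norm2 p.
Proof.
move=> K0 hK p; set a := adjoint A p.
have [->|a0] := eqVneq a 0; first by rewrite normr0 mulr_ge0 ?norm2_ge0.
rewrite -(ler_pM2l (_ : 0 < `|a|)) ?normr_gt0// -expr2 ip_norm.
rewrite -adjointP (le_trans (dotv_le _ _))// mulrA (mulrC `|a|).
by rewrite ler_wpM2r ?norm2_ge0.
Qed.

Lemma opnorm_gt0 : (exists z, A z != 0) -> 0 < opnorm A.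
Proof.
move=> [z Az0]; have [K K0 hK] := linear_norm2_bounded.
have z0 : z != 0 by apply: contraNneq Az0 => ->; rewrite linear0.
have zp : 0 < `|z| by rewrite normr_gt0.
apply: (@lt_le_trans _ _ (norm2 (A (`|z|^-1 *: z)))).
  by rewrite norm2_gt0 linearZ scaler_eq0 invr_eq0 normr_eq0 negb_or z0.
apply: ub_le_sup; last first.
  by exists (`|z|^-1 *: z) => //=; rewrite normrZ normfV normr_id mulVf ?gt_eqF.
exists K => _ [y /= y1 <-]; rewrite (le_trans (hK y))//.
by rewrite -[leRHS]mulr1 ler_wpM2l// ltW.
Qed.

(** Let [G] be a linear map that selects a preimage of every [q] in the range of [A].
    Testing the adjoint at [q] against [G q] recovers the square of [norm2 q], so
    the inverse of a bound on [G] serves as [kappa]. *)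
Lemma adjoint_bounded_below : exists2 kappa : R, 0 < kappa &
  forall z, kappa * norm2 (A z) <= `|adjoint A (A z)|.
Proof.
pose G := ((linfun A)^-1)%VF.
have AG z : A (G (A z)) = A z.
  by rewrite -!(lfunE A) limg_lfunVK// memv_img// memvf.
pose K := \sum_(i < m) `|G (delta_mx i 0)|.
have K0 : 0 <= K by apply: sumr_ge0.
have GK q : `|G q| <= K * norm2 q.
  rewrite {1}(matrix_sum_delta q).
  under eq_bigr do rewrite big_ord1.
  rewrite linear_sum (le_trans (ler_norm_sum _ _ _))// /K mulr_suml.
  apply: ler_sum => i _; rewrite linearZ normrZ mulrC ler_wpM2l//.
  exact: norm2_coord.
exists (K + 1)^-1 => [|z]; first by rewrite invr_gt0 ltr_wpDl.
have K1 : 0 < K + 1 by rewrite ltr_wpDl.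
rewrite mulrC ler_pdivrMr//; set q := A z.
have [->|q0] := eqVneq (norm2 q) 0; first by rewrite mulr_ge0 ?normr_ge0// ltW.
have qp : 0 < norm2 q by rewrite lt0r q0 norm2_ge0.
rewrite -(ler_pM2l qp) -expr2 norm2_sqr.
have -> : dotv q q = ip (G q) (adjoint A q) by rewrite -adjointP /q AG.
rewrite (le_trans (cauchy_schwarz _ _))// mulrC mulrCA ler_wpM2l//.
by rewrite (le_trans (GK _))// mulrC ler_wpM2l ?norm2_ge0// lerDl.
Qed.

End LinearMap.

(** * Gradients *)

Section Gradient.
Context {R : realType} {E : euclideanType R}.
Implicit Types (f : E -> R) (x u v : E).

Lemma gradientP f x v : 'd f x v = ip (gradient f x) v.
Proof.
have lin a u w : 'd f x (a *: u + w) = a * 'd f x u + 'd f x w.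
  by rewrite linearP.
by have /getPex := riesz _ lin; apply.
Qed.

Lemma ip_is_linear (g : E) : linear (ip g : E -> R).
Proof. by move=> a u v; rewrite ipDr ipZr. Qed.

HB.instance Definition _ (g : E) :=
  GRing.isLinear.Build R E R _ (ip g) (ip_is_linear g).

Lemma ip_continuous (g : E) : continuous (ip g : E -> R).
Proof.
move=> x; apply/cvgrPdist_le => e e0.
have gp : 0 < `|g| + 1 by rewrite ltr_wpDl.
near=> u; rewrite -ipNr -ipDr.
rewrite (le_trans (cauchy_schwarz_norm _ _))//.
apply: (@le_trans _ _ ((`|g| + 1) * (e / (`|g| + 1)))); last first.
  by rewrite mulrCA mulfV ?mulr1 ?gt_eqF.
apply: ler_pM => //; first by rewrite lerDl.
near: u; apply/nbhs_normP; exists (e / (`|g| + 1)); first exact: divr_gt0.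
by move=> u /= /ltW.
Unshelve. all: by end_near. Qed.

(** A remainder of order two makes [ip g] the differential of [f] at [x], so that
    gradients can be read off an expansion instead of differentiating. *)
Lemma gradient_quadratic f x (g : E) (K : R) :
  (forall u, `|f u - f x - ip g (u - x)| <= K * `|u - x| ^+ 2) -> gradient f x = g.
Proof.
move=> hq; apply: ip_inj => v; rewrite -gradientP.
rewrite (@diff_unique _ _ _ f (ip g : {linear E -> R}) x)//.
  exact: ip_continuous.
apply/eqaddoP => e e0.
have Kp : 0 < `|K| + 1 by rewrite ltr_wpDl.
near=> h.
have := hq (h + x); rewrite addrK /=.
have -> : (f \o shift x - (cst (f x) + ip g)) h = f (h + x) - f x - ip g h.
  by rewrite [LHS]/=; rewrite opprD addrA.
move/le_trans; apply; rewrite expr2 mulrA ler_wpM2r//.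
apply: (@le_trans _ _ ((`|K| + 1) * `|h|)).
  by rewrite ler_wpM2r// (le_trans (ler_norm _))// lerDl.
rewrite mulrC -ler_pdivlMr//; near: h.
apply: nbhs0_le; exact: divr_gt0.
Unshelve. all: by end_near. Qed.

(** Along the segment from [x] to [u] convexity bounds every difference quotient by
    [f u - f x], and the quotients tend to the differential. *)
Lemma convex_gradient_le f x u : convex_function setT f -> differentiable f x ->
  ip (gradient f x) (u - x) <= f u - f x.
Proof.
move=> cf df; rewrite -gradientP; set v := u - x.
have [dfc] := (diff_locallyP _ _).1 df => /eqaddoP dfo.
apply/ler_addgt0Pl => e e0.
have vp : 0 < `|v| + 1 by rewrite ltr_wpDl.
have /nbhs_normP[d /= d0 dP] := dfo _ (divr_gt0 e0 vp).
pose t := Num.min 1 (d / 2 / (`|v| + 1)).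
have t0 : 0 < t by rewrite /t lt_min ltr01 !divr_gt0.
have t1 : t <= 1 by rewrite /t ge_min lexx.
have tv : `|t *: v| < d.
  rewrite normrZ gtr0_norm// (@le_lt_trans _ _ (d / 2 / (`|v| + 1) * (`|v| + 1)))//.
    by rewrite ler_pM ?(ltW t0) ?lerDl// /t ge_min lexx orbT.
  by rewrite divfK ?gt_eqF// ltr_pdivrMr// ltr_pMr// ltrDl.
have := dP (t *: v); rewrite /= sub0r normrN => /(_ tv).
have -> : (f \o shift x - (cst (f x) + 'd f x)) (t *: v)
    = f (t *: v + x) - f x - 'd f x (t *: v).
  by rewrite [LHS]/=; rewrite opprD addrA.
have dZ : 'd f x (t *: v) = t * 'd f x v by exact: linearZ.
rewrite dZ normrZ gtr0_norm// => /ler_normlP[h _].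
have hc : f (t *: v + x) <= t * f u + (1 - t) * f x.
  have := cf (Itv01 (ltW t0) t1) u x; rewrite !inE => /(_ I I).
  congr (f _ <= _); rewrite /conv/= /v scalerBr scalerBl scale1r.
  by rewrite -addrA; congr (_ + _); rewrite addrC.
have he : e / (`|v| + 1) * (t * `|v|) <= t * e.
  by rewrite mulrAC ler_pdivrMr//; have := mulr_gt0 e0 t0; lra.
by rewrite -(ler_pM2l t0); lra.
Qed.

End Gradient.

(** * Minimizing a smooth function plus a convex regularizer *)

Section QuadraticModel.
Context {R : realType} {E : euclideanType R}.
Implicit Types (F : E -> R) (G : E -> E) (K : R).

(** First-order expansions with a uniform quadratic remainder.  They are stable under
    sums, so every proximal objective below is such an [F] plus the regularizer. *)
Definition quadratic_model F G K :=
  forall x u, `|F u - F x - ip (G x) (u - x)| <= K * `|u - x| ^+ 2.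

Lemma quadratic_modelD F G K F' G' K' :
  quadratic_model F G K -> quadratic_model F' G' K' ->
  quadratic_model (fun u => F u + F' u) (fun u => G u + G' u) (K + K').
Proof.
move=> FG FG' x u; rewrite mulrDl ipDl.
apply: le_trans (lerD (FG x u) (FG' x u)).
rewrite [X in `|X| <= _](_ : _ = (F u - F x - ip (G x) (u - x))
  + (F' u - F' x - ip (G' x) (u - x))); last by lra.
exact: ler_normD.
Qed.

Lemma quadratic_model_sq (a : R) (c : E) : 0 <= a ->
  quadratic_model (fun u => a / 2 * `|u - c| ^+ 2) (fun u => a *: (u - c)) (a / 2).
Proof.
move=> a0 x u.
have -> : a / 2 * `|u - c| ^+ 2 - a / 2 * `|x - c| ^+ 2 - ip (a *: (x - c)) (u - x)
    = a / 2 * `|u - x| ^+ 2.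
  by rewrite !ip_norm !ipE (ipC c u) (ipC x u) (ipC c x); lra.
by rewrite ger0_norm// mulr_ge0 ?sqr_ge0 ?divr_ge0.
Qed.

Lemma quadratic_model_ip (g : E) : quadratic_model (fun u => ip g u) (fun=> g) 0.
Proof. by move=> x u; rewrite -!ipNr -!ipDr subrr ip0r normr0 mul0r. Qed.

Lemma quadratic_model_continuous F G K : quadratic_model F G K -> continuous F.
Proof.
move=> FG x; apply/cvgrPdist_le => e e0.
pose C := `|G x| + `|K| + 1.
have C0 : 0 < C by rewrite /C; have := normr_ge0 (G x); have := normr_ge0 K; lra.
apply/nbhs_normP; exists (Num.min 1 (e / C)).
  by rewrite /= lt_min ltr01 divr_gt0.
move=> u /=; rewrite lt_min distrC => /andP[u1 uC]; rewrite distrC.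
have := FG x u; have := cauchy_schwarz_norm (G x) (u - x).
move: u1 uC; rewrite ltr_pdivlMr//; set n := `|u - x| => n1 nC hcs hq.
have n0 : 0 <= n by exact: normr_ge0.
have hK : K * n ^+ 2 <= `|K| * n.
  apply: (@le_trans _ _ (`|K| * n ^+ 2)).
    by rewrite ler_wpM2r ?sqr_ge0 ?ler_norm.
  by rewrite ler_wpM2l// expr2 ler_piMl// ltW.
have -> : F u - F x = (F u - F x - ip (G x) (u - x)) + ip (G x) (u - x) by lra.
rewrite (le_trans (ler_normD _ _))//.
move: nC; rewrite /C; lra.
Qed.

End QuadraticModel.

Section Regularizer.
Context {R : realType} {E : euclideanType R}.
Implicit Types (h : E -> \bar R) (x u : E).

(** Lipschitz continuity on the domain makes the finite part of [h] continuous there,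
    which with compactness yields the minimizers that define the algorithms. *)
Definition regular_term h :=
  [/\ proper_efunction h, convex_efunction h, compact (edom h) &
      exists k : R, k.-lipschitz_(edom h) (fun z => fine (h z))].

Section Fixed.
Context h (hreg : regular_term h).

Lemma edom_fineK x : edom h x -> h x = (fine (h x))%:E.
Proof.
have [[hN _] _ _ _] := hreg => hx; rewrite fineK// fin_numE.
by rewrite gt_eqF ?hN// lt_eqF.
Qed.

Lemma not_edom x : ~ edom h x -> h x = +oo%E.
Proof. by rewrite /edom /=; case: (h x) => // r; rewrite ltry. Qed.

Lemma edom_convex x u (t : R) : edom h x -> edom h u -> 0 <= t <= 1 ->
  edom h (t *: x + (1 - t) *: u) /\
  fine (h (t *: x + (1 - t) *: u)) <= t * fine (h x) + (1 - t) * fine (h u).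
Proof.
move=> hx hu t01; have [_ hc _ _] := hreg.
have := hc x u t t01; rewrite (edom_fineK _ hx) (edom_fineK _ hu) -!EFinM -EFinD => hle.
have hd : edom h (t *: x + (1 - t) *: u) by apply: le_lt_trans hle _; exact: ltry.
by split=> //; move: hle; rewrite (edom_fineK _ hd) lee_fin.
Qed.

Lemma edom_subdifferentialP x g : edom h x ->
  subdifferential h x g <->
  forall u, edom h u -> fine (h x) + ip g (u - x) <= fine (h u).
Proof.
move=> hx; split=> [hg u hu|hg u].
  have := hg u; rewrite (edom_fineK _ hx) (edom_fineK _ hu) -EFinD lee_fin//.
have [hu|/not_edom ->] := pselect (edom h u); last exact: leey.
by rewrite (edom_fineK _ hx) (edom_fineK _ hu) -EFinD lee_fin hg.
Qed.

Lemma subdifferential_le x u g : edom h x -> edom h u -> subdifferential h x g ->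
  fine (h x) + ip g (u - x) <= fine (h u).
Proof.
by move=> hx hu hg; exact: (iffLR (edom_subdifferentialP _ _ hx) hg).
Qed.

Lemma is_minimizerP (F : E -> R) x :
  is_minimizer (fun u => (F u)%:E + h u)%E x <->
  edom h x /\ forall u, edom h u -> F x + fine (h x) <= F u + fine (h u).
Proof.
have [[_ [d hd]] _ _ _] := hreg; split=> [hm|[hx hm] u].
  have hx : edom h x.
    apply: contrapT => /not_edom hx; have := hm d.
    by rewrite hx (edom_fineK _ hd) -EFinD addey// leye_eq.
  split=> // u hu; have := hm u.
  by rewrite (edom_fineK _ hx) (edom_fineK _ hu) -!EFinD lee_fin.
have [hu|/not_edom ->] := pselect (edom h u); last by rewrite addey// leey.
by rewrite (edom_fineK _ hx) (edom_fineK _ hu) -!EFinD lee_fin hm.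
Qed.

Lemma composite_minimizer_exists (F : E -> R) G K : quadratic_model F G K ->
  exists x, is_minimizer (fun u => (F u)%:E + h u)%E x.
Proof.
move=> FG; have [[_ hne] _ hcomp [k hk]] := hreg.
have hkl x u : edom h x -> edom h u ->
    `|fine (h x) - fine (h u)| <= k * `|x - u|.
  by move=> hx hu; exact: (hk (x, u) (conj hx hu)).
have cont : {within edom h, continuous (fun u => F u + fine (h u))}.
  apply/subspace_continuousP => x hx; apply: cvgD.
    by apply: cvg_within_filter; exact: (quadratic_model_continuous _ _ _ FG).
  apply/cvgrPdist_le => e e0.
  have kp : 0 < `|k| + 1 by rewrite ltr_wpDl.
  rewrite near_withinE; apply/nbhs_normP; exists (e / (`|k| + 1)); first exact: divr_gt0.
  move=> u /=; rewrite ltr_pdivlMr// => xu hu.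
  rewrite (le_trans (hkl _ _ hx hu))//; have := normr_ge0 (x - u).
  have := ler_norm k; nra.
have [x hx hmin] := compact_EVT_min hne hcomp cont.
exists x; apply/is_minimizerP; rewrite inE in hx; split=> // u hu.
by apply: hmin; rewrite inE.
Qed.

(** First-order optimality: moving from the minimizer towards [u] by a fraction [t]
    changes the smooth part by [t ip (G x) (u - x)] up to [O(t^2)], and the convex
    part by at most [t (h u - h x)]. *)
Lemma composite_minimizer_subgradient (F : E -> R) G K x : quadratic_model F G K ->
  is_minimizer (fun u => (F u)%:E + h u)%E x ->
  edom h x /\ subdifferential h x (- G x).
Proof.
move=> FG /is_minimizerP[hx hmin]; split=> //.
apply/edom_subdifferentialP => // u hu; rewrite ipNl.
apply/ler_addgt0Pl => e e0.
pose n := `|u - x|; pose c := `|K| * n ^+ 2 + 1.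
have c0 : 0 < c by rewrite /c ltr_wpDl// mulr_ge0 ?sqr_ge0.
pose t := Num.min 1 (e / c).
have t0 : 0 < t by rewrite /t lt_min ltr01 divr_gt0.
have t1 : t <= 1 by rewrite /t ge_min lexx.
have tc : t * c <= e by rewrite -ler_pdivlMr// /t ge_min lexx orbT.
have t01 : 0 <= t <= 1 by rewrite ltW.
have [hd hle] := edom_convex u x t hu hx t01.
have := hmin _ hd; have := FG x (t *: u + (1 - t) *: x).
have -> : t *: u + (1 - t) *: x - x = t *: (u - x).
  by rewrite scalerBl scale1r scalerBr -addrA; congr (_ + _); rewrite addrAC subrr add0r.
rewrite normrZ gtr0_norm// -/n ipZr => /ler_normlP[_ hF] hm.
have hK : K * (t * n) ^+ 2 <= t * (t * c).
  have : K * n ^+ 2 <= c.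
    by rewrite /c (@le_trans _ _ (`|K| * n ^+ 2)) ?lerDl// ler_wpM2r ?sqr_ge0 ?ler_norm.
  have -> : K * (t * n) ^+ 2 = t * (t * (K * n ^+ 2)) by ring.
  by move=> hKc; rewrite !(ler_wpM2l (ltW t0)).
have htc : t * (t * c) <= t * e by rewrite ler_wpM2l ?(ltW t0).
by rewrite -(ler_pM2l t0); lra.
Qed.

End Fixed.
End Regularizer.

(** * Proximal steps, inner solver and backtracking *)

Section Archimedes.
Context {R : realType}.

Lemma archi_nat (y : R) : exists k, y <= k%:R.
Proof.
exists (Num.truncn `|y|).+1; rewrite (le_trans (ler_norm y))// ltW// truncnS_gt//.
Qed.

(** By Bernoulli's inequality. *)
Lemma archi_expr (a y : R) : 1 < a -> exists k, y <= a ^+ k.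
Proof.
move=> a1; have [k hk] := archi_nat (y / (a - 1)); exists k.
move: hk; rewrite ler_pdivrMr ?subr_gt0// => hy; apply: (le_trans hy).
have : 1 + k%:R * (a - 1) <= a ^+ k.
  elim: k {hy} => [|k IH]; first by rewrite mul0r addr0 expr0.
  have kd : 0 <= k%:R * ((a - 1) * (a - 1)) by rewrite !mulr_ge0// subr_ge0 ltW.
  have a0 : 0 <= a by lra.
  by rewrite exprS -natr1; have := ler_wpM2l a0 IH; lra.
lra.
Qed.

Lemma archi_pow2 (y : R) : exists k, y <= 2 ^+ k.
Proof. by apply: archi_expr; rewrite ltr1n. Qed.

End Archimedes.

Section ProximalSteps.
Context {R : realType} {E : euclideanType R}.
Implicit Types (x u y z : E) (M : R).

(** The upper bound has [L] in place of the usual [L / 2]: in this form it follows from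
    convexity and the Lipschitz continuity of the gradient by Cauchy-Schwarz, without
    integrating along the segment.  Only the threshold at which the backtracking is
    bound to accept is affected; it becomes [2 * L]. *)
Definition smooth_convex (f : E -> R) (L : R) := forall x u,
  0 <= f u - f x - ip (gradient f x) (u - x) <= L * `|u - x| ^+ 2 /\
  `|gradient f u - gradient f x| <= L * `|u - x|.

Context (f : E -> R) (h : E -> \bar R) (L : R).
Context (L0 : 0 < L) (hsm : smooth_convex f L) (hreg : regular_term h).

Let g x := gradient f x.
Let H u := fine (h u).

Lemma smooth_convex_model : quadratic_model f (gradient f) L.
Proof.
by move=> x u; have [/andP[f0 fL] _] := hsm x u; rewrite ger0_norm.
Qed.

(** The proximal objective as a real number, on the domain of [h]. *)
Definition prox_value (sigma : R) (xbar u : E) : R :=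
  f u + sigma / 2 * `|u - xbar| ^+ 2 + fine (h u).

Lemma prox_objectiveE sigma xbar : prox_objective f h sigma xbar =
  (fun u => (f u + sigma / 2 * `|u - xbar| ^+ 2)%:E + h u)%E.
Proof. by apply/funext => u; rewrite /prox_objective EFinD addeAC. Qed.

Lemma prox_objective_value sigma xbar u : edom h u ->
  prox_objective f h sigma xbar u = (prox_value sigma xbar u)%:E.
Proof. by move=> hu; rewrite prox_objectiveE (edom_fineK _ hreg u hu) -EFinD. Qed.

Lemma subgradient_le x y s t : edom h x -> edom h y ->
  subdifferential h x (- s) -> subdifferential h y (- t) -> ip (s - t) (x - y) <= 0.
Proof.
move=> hx hy hs ht.
move: (subdifferential_le _ hreg _ _ _ hx hy hs).
move: (subdifferential_le _ hreg _ _ _ hy hx ht); rewrite -/(H x) -/(H y) !ipE; lra.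
Qed.

Lemma gradient_monotone x y : 0 <= ip (g x - g y) (x - y).
Proof.
have [/andP[hx _] _] := hsm x y; have [/andP[hy _] _] := hsm y x.
move: hx hy; rewrite -/(g x) -/(g y); move: (g x) (g y) => a b.
by rewrite !ipE; lra.
Qed.

Section Step.
Context (sigma : R) (xbar : E).
Context (sigma0 : 0 < sigma).

Lemma prox_smooth_model :
  quadratic_model (fun u => f u + sigma / 2 * `|u - xbar| ^+ 2)
    (fun u => g u + sigma *: (u - xbar)) (L + sigma / 2).
Proof.
by apply: quadratic_modelD; [exact: smooth_convex_model|exact/quadratic_model_sq/ltW].
Qed.

Lemma prox_minimizer_exists : exists xs, is_minimizer (prox_objective f h sigma xbar) xs.
Proof.
rewrite prox_objectiveE.
exact: composite_minimizer_exists _ hreg _ _ _ prox_smooth_model.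
Qed.

Lemma prox_minimizer_optimal xs : is_minimizer (prox_objective f h sigma xbar) xs ->
  edom h xs /\ subdifferential h xs (- (g xs + sigma *: (xs - xbar))).
Proof.
rewrite prox_objectiveE => hm.
exact: composite_minimizer_subgradient _ hreg _ _ _ _ prox_smooth_model hm.
Qed.

(** Strong convexity, read off the optimality condition at [xs]. *)
Lemma prox_growth xs u : is_minimizer (prox_objective f h sigma xbar) xs -> edom h u ->
  sigma / 2 * `|u - xs| ^+ 2 <= prox_value sigma xbar u - prox_value sigma xbar xs.
Proof.
move=> /prox_minimizer_optimal[hs hsub] hu.
move: (subdifferential_le _ hreg _ _ _ hs hu hsub); have [/andP[+ _] _] := hsm xs u.
rewrite /prox_value -/(H u) -/(H xs) -/(g xs) !ip_norm !ipE.
by rewrite (ipC u xs) (ipC xbar u) (ipC xbar xs); lra.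
Qed.

Lemma bt_plusplus_optimal x M : 0 < M -> let y := bt_plusplus f h sigma x xbar M in
  edom h y /\
  subdifferential h y (- (g x + (sigma *: (y - xbar) + (2 * M) *: (y - x)))).
Proof.
move=> M0; rewrite /bt_plusplus; set phi := (X in argmin X); set y := argmin phi => /=.
have phiE : phi = (fun u => (ip (g x) u
    + (sigma / 2 * `|u - xbar| ^+ 2 + (2 * M) / 2 * `|u - x| ^+ 2))%:E + h u)%E.
  apply/funext => u; rewrite /phi addeAC -EFinD.
  by congr (_%:E + _)%E; lra.
have M2 : 0 <= 2 * M by lra.
have qm := quadratic_modelD _ _ _ _ _ _ (quadratic_model_ip (g x))
  (quadratic_modelD _ _ _ _ _ _ (quadratic_model_sq _ xbar (ltW sigma0))
    (quadratic_model_sq (2 * M) x M2)).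
have hm : is_minimizer phi y.
  by apply: getPex; rewrite phiE; exact: composite_minimizer_exists hreg _ _ _ qm.
by rewrite phiE in hm; exact: composite_minimizer_subgradient hreg _ _ _ _ qm hm.
Qed.

End Step.

Lemma bt_plus_optimal x M : 0 < M -> let y := bt_plus f h x M in
  edom h y /\ subdifferential h y (- (g x + (2 * M) *: (y - x))).
Proof.
move=> M0; rewrite /bt_plus; set phi := (X in argmin X); set y := argmin phi => /=.
have phiE : phi = (fun u => (ip (g x) u + (2 * M) / 2 * `|u - x| ^+ 2)%:E + h u)%E.
  apply/funext => u; rewrite /phi addeAC -EFinD.
  by congr (_%:E + _)%E; lra.
have M2 : 0 <= 2 * M by lra.
have qm := quadratic_modelD _ _ _ _ _ _ (quadratic_model_ip (g x))
  (quadratic_model_sq (2 * M) x M2).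
have hm : is_minimizer phi y.
  by apply: getPex; rewrite phiE; exact: composite_minimizer_exists hreg _ _ _ qm.
by rewrite phiE in hm; exact: composite_minimizer_subgradient hreg _ _ _ _ qm hm.
Qed.

Section Acceptance.
Context (sigma : R) (x xbar : E).

Lemma bt_accept_large M : 2 * L <= M -> bt_accept f h sigma x xbar M.
Proof.
move=> LM; split.
  set y := bt_plusplus _ _ _ _ _ _.
  have [/andP[_ hL] _] := hsm x y; apply: (le_trans hL).
  by rewrite ler_wpM2r ?sqr_ge0//; lra.
set y := bt_plus _ _ _ _; have [/andP[h0 hL] h1] := hsm x y.
apply: (le_trans h1); rewrite ler_wpM2r//.
by move: (L0) LM; lra.
Qed.


(** The number [j] of doublings is recorded together with its effect on the estimate:
    along a run the estimates are chained, so the doublings of all the calls add up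
    to a single exponent. *)
Lemma backtracking_spec M xpp xp M' n (Mmax : R) : 0 < M -> M <= Mmax -> 4 * L <= Mmax ->
  backtracking f h sigma x xbar M xpp xp M' n ->
  [/\ xpp = bt_plusplus f h sigma x xbar M', xp = bt_plus f h x M',
      bt_accept f h sigma x xbar M', 0 < M' <= Mmax &
      exists2 j, n = (2 + j)%N & M' = 2 ^+ j * M].
Proof.
move=> + + Lmax run; elim: run => {M xpp xp M' n} [M hM|M xpp xp M' n rej run IH] M0 Mle.
  by split=> //; [rewrite M0 | exists 0%N; rewrite ?addn0// expr0 mul1r].
have [ML|ML] := leP (2 * L) M; first by have := rej (bt_accept_large _ ML).
have M20 : 0 < 2 * M by lra.
have M2le : 2 * M <= Mmax by lra.
have [-> -> acc M'0 [j nj Mj]] := IH M20 M2le; rewrite nj Mj.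
by rewrite -Mj; split=> //; exists j.+1; rewrite ?addnS// Mj exprSr mulrA.
Qed.

Lemma backtracking_exists M : 0 < M ->
  exists xpp xp M' n, backtracking f h sigma x xbar M xpp xp M' n.
Proof.
move=> M0.
have [i hi] : exists i, 2 * L <= 2 ^+ i * M.
  have [i] := archi_pow2 (2 * L / M).
  by rewrite ler_pdivrMr//; exists i.
elim: i M M0 hi => [|i IH] M M0 hi.
  rewrite expr0 mul1r in hi.
  by do 4!eexists; apply: bt_stop; exact: bt_accept_large.
have [acc|rej] := pselect (bt_accept f h sigma x xbar M).
  by do 4!eexists; exact: bt_stop.
have M20 : 0 < 2 * M by lra.
have [|xpp [xp [M' [n run]]]] := IH (2 * M) M20; first by rewrite mulrA -exprSr.
by exists xpp, xp, M', n.+1; exact: bt_double.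
Qed.

End Acceptance.

Section SolverCall.
Context (cA Lf : R) (slv : @solver R E).
Context (hslv : solver_guarantee cA slv f Lf h).
Context (sigma : R) (xbar xprev : E).
Context (sigma0 : 0 < sigma).
Context (hxbar : edom h xbar) (hxprev : edom h xprev).

Let K0 := 8 * Num.sqrt (2 * `|cA * Lf|).

Lemma solver_stop_large k : (0 < k)%N -> K0 / Num.sqrt sigma <= k%:R ->
  solver_stop slv f h sigma xbar xprev k.
Proof.
move=> k0 hk; apply: le_trans hk; rewrite /K0 -[leRHS]mulrA ler_wpM2l// -sqrtrV ?(ltW sigma0)//.
have [xs hxs] := prox_minimizer_exists sigma xbar sigma0.
have := hslv sigma xbar xprev xs k sigma0 hxbar hxprev hxs k0.
case: (slv _ _ _ _ _ _) => xk Lk [_ hL _] /=.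
rewrite -sqrtrM ?mulr_ge0// ler_sqrt ?mulr_ge0 ?invr_ge0 ?(ltW sigma0)//.
rewrite ler_wpM2r ?invr_ge0 ?(ltW sigma0)// ler_wpM2l//.
by rewrite (le_trans hL)// ler_norm.
Qed.

Lemma solver_call_exists : exists x n, solver_call slv f h sigma xbar xprev x n.
Proof.
pose P k := (0 < k)%N && `[< solver_stop slv f h sigma xbar xprev k >].
have exP : exists k, P k.
  have [k hk] := archi_nat (K0 / Num.sqrt sigma).
  exists k.+1; apply/andP; split=> //; apply/asboolP/solver_stop_large => //.
  by rewrite (le_trans hk)// ler_nat.
have := ex_minnP exP; case=> n /andP[n0 /asboolP ns] nmin.
exists (slv f h sigma xbar xprev n).1, n; split=> // k /andP[k0 kn] ks.
have : (n <= k)%N by apply: nmin; rewrite /P k0; apply/asboolP.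
by rewrite leqNgt kn.
Qed.

(** The last index at which the solver did not stop is below [K0 / sqrt sigma]. *)
Lemma solver_call_cost x n : solver_call slv f h sigma xbar xprev x n ->
  n%:R <= 2 + K0 / Num.sqrt sigma.
Proof.
move=> [n0 _ nmin _]; case: n n0 nmin => // -[_ _|n _ nmin].
  by rewrite ler_wpDr// ?mulr_ge0 ?invr_ge0 ?sqrtr_ge0// ler_nat.
rewrite leNgt; apply/negP => hn; apply: (nmin n.+1); first by rewrite /= ltnSn.
apply: solver_stop_large => //; rewrite -natr1 in hn.
by move: hn; rewrite -natr1; lra.
Qed.

(** The stopping rule [n >= 8 sqrt (2 L / sigma)] turns the [L / n^2] rate into the
    factor [sigma / 128]. *)
Lemma solver_call_accuracy x n xs : solver_call slv f h sigma xbar xprev x n ->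
  is_minimizer (prox_objective f h sigma xbar) xs ->
  edom h x /\ prox_value sigma xbar x - prox_value sigma xbar xs
    <= sigma / 128 * `|xprev - xs| ^+ 2.
Proof.
move=> [n0 ns _ ->] hxs.
have [hs _] := prox_minimizer_optimal _ _ sigma0 _ hxs.
have := hslv sigma xbar xprev xs n sigma0 hxbar hxprev hxs n0.
move: ns; rewrite /solver_stop.
case: (slv _ _ _ _ _ _) => xk Lk /= ns [hx _].
rewrite !prox_objective_value// -EFinB lee_fin => hle; split=> //.
apply: (le_trans hle); rewrite ler_wpM2r ?sqr_ge0//.
have np : 0 < n%:R :> R by rewrite ltr0n.
rewrite ler_pdivrMr ?exprn_gt0//.
have [Lk0|Lk0] := leP Lk 0.
  by rewrite (le_trans Lk0)// mulr_ge0 ?sqr_ge0// divr_ge0 ?(ltW sigma0).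
have r0 : 0 <= 2 * Lk / sigma by rewrite divr_ge0 ?(ltW sigma0)// mulr_ge0 ?(ltW Lk0).
have : (8 * Num.sqrt (2 * Lk / sigma)) ^+ 2 <= n%:R ^+ 2.
  by rewrite ler_pXn2r ?nnegrE ?mulr_ge0 ?sqrtr_ge0.
rewrite exprMn sqr_sqrtr// => h2.
have -> : Lk = sigma / 128 * (8 ^+ 2 * (2 * Lk / sigma)).
  by field; rewrite gt_eqF.
by rewrite ler_wpM2l// divr_ge0 ?(ltW sigma0).
Qed.

End SolverCall.


Section Residual.
Context (sigma : R) (xbar xs x : E) (M a : R).
Context (sigma0 : 0 < sigma).
Context (hxs : is_minimizer (prox_objective f h sigma xbar) xs).
Context (hx : edom h x).
Context (a0 : 0 <= a).
Context (hacc : prox_value sigma xbar x - prox_value sigma xbar xs <= sigma / 128 * a ^+ 2).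

(** Strong growth against accuracy: [sigma / 2 |x - xs|^2 <= sigma / 128 a^2]. *)
Lemma prox_near : `|x - xs| <= a / 8.
Proof.
have hle := le_trans (prox_growth _ _ sigma0 _ _ hxs hx) hacc.
rewrite -(ler_pXn2r (ltn0Sn 1)) ?nnegrE ?divr_ge0//.
rewrite -(ler_pM2l sigma0) expr_div_n; move: hle; lra.
Qed.

Context (M0 : 0 < M <= sigma).
Context (acc : bt_accept f h sigma x xbar M).

Let y := bt_plusplus f h sigma x xbar M.
Let z := bt_plus f h x M.

(** Acceptance puts the value of [f] at [y] below the model by half of the proximal
    term [M |y - x|^2], which adds [M / 2] to the strong convexity [sigma + 2 M] of the
    model. *)
Lemma plusplus_decrease : edom h y /\
  (3 / 2 * M + sigma / 2) * `|x - y| ^+ 2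
    <= prox_value sigma xbar x - prox_value sigma xbar y.
Proof.
have [M00 _] := andP M0.
have [hy hsub] := bt_plusplus_optimal sigma xbar sigma0 x M M00; split=> //.
have := subdifferential_le _ hreg _ _ _ hy hx hsub.
have [+ _] := acc; rewrite -/y -/(g x) /prox_value -/(H x) -/(H y) !ip_norm !ipE.
by rewrite (ipC y x) (ipC xbar x) (ipC xbar y); lra.
Qed.

(** The gradient test gives [|v| <= 3 M |x - z|].  The point [z] differs from [y] only
    through the regularization, so [2 M |z - y| <= sigma |y - xbar|], while
    [M |x - y|] is controlled by the accuracy at [x] because [M <= sigma]. *)
Lemma residual_bound : let v := 2 * M *: (x - z) - gradient f x + gradient f z in
  [/\ edom h z, subdifferential h z (v - gradient f z) &
      `|v| <= 3 / 2 * (sigma * (`|xs - xbar| + a))].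
Proof.
have /andP[M00 Ms] := M0.
have [hz hsubz] := bt_plus_optimal x M M00.
have [hy hsuby] := bt_plusplus_optimal sigma xbar sigma0 x M M00.
have [_ hdec] := plusplus_decrease.
move=> v; split=> //.
  rewrite /v addrK; congr (subdifferential h z _): hsubz.
  by rewrite opprD -scalerN opprB addrC.
have [hs _] := prox_minimizer_optimal _ _ sigma0 _ hxs.
have s20 : 0 <= sigma / 2 by rewrite divr_ge0// ltW.
have gap1 := prox_growth _ _ sigma0 _ _ hxs hy.
(* [y] is no worse than [x] for the proximal objective *)
have d1 : `|y - xs| <= a / 8.
  rewrite -(ler_pXn2r (ltn0Sn 1)) ?nnegrE ?divr_ge0//.
  have : 0 <= (3 / 2 * M + sigma / 2) * `|x - y| ^+ 2 by rewrite mulr_ge0 ?sqr_ge0//; lra.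
  move=> dec0; rewrite -(ler_pM2l sigma0) expr_div_n; move: (hacc) gap1 hdec dec0; lra.
have d2 : M * `|x - y| <= sigma * a / 16.
  rewrite -(ler_pXn2r (ltn0Sn 1)) ?nnegrE ?divr_ge0 ?mulr_ge0 ?(ltW sigma0) ?(ltW M00)//.
  have : 2 * M * `|x - y| ^+ 2 <= sigma / 128 * a ^+ 2.
    apply: (@le_trans _ _ ((3 / 2 * M + sigma / 2) * `|x - y| ^+ 2)).
      by rewrite ler_wpM2r ?sqr_ge0//; lra.
    have : 0 <= sigma / 2 * `|y - xs| ^+ 2 by rewrite mulr_ge0 ?sqr_ge0.
    move: (hacc) gap1 hdec; lra.
  move/(ler_wpM2l (ltW M00)) => h1.
  have h2 : M * (sigma / 128 * a ^+ 2) <= sigma * (sigma / 128 * a ^+ 2).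
    by rewrite ler_wpM2r// mulr_ge0 ?sqr_ge0 ?divr_ge0 ?(ltW sigma0).
  by rewrite expr_div_n !exprMn; lra.
(* monotonicity of the subdifferential of [h] between [z] and [y] *)
have d3 : 2 * M * `|z - y| <= sigma * `|y - xbar|.
  have := subgradient_le _ _ _ _ hz hy hsubz hsuby.
  have -> : g x + 2 * M *: (z - x) - (g x + (sigma *: (y - xbar) + 2 * M *: (y - x)))
      = 2 * M *: (z - y) - sigma *: (y - xbar).
    rewrite opprD addrACA subrr add0r opprD addrCA addrC -scalerBr.
    by rewrite opprB addrA subrK.
  rewrite ipDl ipNl !ipZl -ip_norm => hmon.
  have [->|zy] := eqVneq `|z - y| 0; first by rewrite mulr0 mulr_ge0 ?(ltW sigma0).
  have zy0 : 0 < `|z - y| by rewrite lt0r zy /=.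
  have := ler_wpM2l (ltW sigma0) (cauchy_schwarz (y - xbar) (z - y)) => hcs.
  by rewrite -(ler_pM2r zy0); move: hcs hmon; lra.
have hv : `|v| <= 3 * (M * `|x - z|).
  have [_ hg] := acc; rewrite -/z in hg.
  rewrite /v -addrA (le_trans (ler_normD _ _))// normrZ gtr0_norm ?mulr_gt0//.
  by rewrite (addrC (- gradient f x)) (distrC x z); move: hg; lra.
have t1 : `|x - z| <= `|x - y| + `|z - y|.
  by rewrite (distrC z) (le_trans _ (ler_normD _ _))// addrA subrK.
have t2 : `|y - xbar| <= `|y - xs| + `|xs - xbar|.
  by rewrite (le_trans _ (ler_normD _ _))// addrA subrK.
have := ler_wpM2l (ltW M00) t1; have := ler_wpM2l (ltW sigma0) t2.
have := ler_wpM2l (ltW sigma0) d1.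
have := mulr_ge0 (ltW sigma0) a0.
by lra.
Qed.

End Residual.

(** The next objective is, up to a constant, the current one plus
    [3 sigma / 2 |u - x|^2]: its minimizer is a proximal step from [x], hence lies
    between [x] and the current minimizer. *)
Lemma regularization_drift sigma xbar x xs xs' : 0 < sigma ->
  let xbar' := (1 - (1 - sigma / (4 * sigma))) *: xbar + (1 - sigma / (4 * sigma)) *: x in
  is_minimizer (prox_objective f h sigma xbar) xs ->
  is_minimizer (prox_objective f h (4 * sigma) xbar') xs' ->
  4 * sigma * (`|xs' - xbar'| + `|x - xs'|) <= sigma * (`|xs - xbar| + 8 * `|x - xs|).
Proof.
move=> s0 xbar' hm hm'.
have s40 : 0 < 4 * sigma by lra.
have [hs sub] := prox_minimizer_optimal _ _ s0 _ hm.
have [hs' sub'] := prox_minimizer_optimal _ _ s40 _ hm'.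
have exb : 4 * sigma *: (xs' - xbar') = sigma *: (xs' - xbar) + 3 * sigma *: (xs' - x).
  have -> : xbar' = 4^-1 *: xbar + (3 / 4) *: x.
    by congr (_ *: _ + _ *: _); field; rewrite gt_eqF.
  by apply: ip_inj => v; rewrite !ipE; lra.
have hmon : ip (xs' - x) (xs' - xs) <= 0.
  have h1 := gradient_monotone xs' xs.
  have := subgradient_le _ _ _ _ hs' hs sub' sub; rewrite exb => h2.
  have h3 : 0 <= sigma * `|xs' - xs| ^+ 2 by rewrite mulr_ge0 ?sqr_ge0// ltW.
  rewrite -(pmulr_rle0 _ s0); move: h1 h2 h3; move: (g xs) (g xs') => a b.
  rewrite !ip_norm !ipE (ipC xs xs') (ipC x xs) (ipC x xs') (ipC xbar xs) (ipC xbar xs').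
  by lra.
have e1 : `|xs' - xs| <= `|x - xs|.
  rewrite -(ler_pXn2r (ltn0Sn 1)) ?nnegrE//; have := sqr_ge0 `|xs' - x|.
  move: hmon; rewrite !ip_norm !ipE (ipC xs xs') (ipC x xs) (ipC x xs'); lra.
have e2 : `|xs' - x| <= `|x - xs|.
  rewrite -(ler_pXn2r (ltn0Sn 1)) ?nnegrE//; have := sqr_ge0 `|xs' - xs|.
  move: hmon; rewrite !ip_norm !ipE (ipC xs xs') (ipC x xs) (ipC x xs'); lra.
have n1 : 4 * sigma * `|xs' - xbar'| <= sigma * `|xs' - xbar| + 3 * sigma * `|xs' - x|.
  rewrite -(gtr0_norm s40) -normrZ exb (le_trans (ler_normD _ _))//.
  by rewrite !normrZ !gtr0_norm// mulr_gt0.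
have n2 : `|xs' - xbar| <= `|xs' - xs| + `|xs - xbar|.
  by rewrite (le_trans _ (ler_normD _ _))// addrA subrK.
rewrite (distrC x xs').
have := ler_wpM2l (ltW s0) n2; have := ler_wpM2l (ltW s0) e1; have := ler_wpM2l (ltW s0) e2.
move: n1; lra.
Qed.


End ProximalSteps.

(** * Runs of AR-L and PF-AR *)

Section Algorithms.
Context {R : realType} {E : euclideanType R}.
Context (f : E -> R) (h : E -> \bar R) (L : R).
Context (L0 : 0 < L) (hsm : smooth_convex f L) (hreg : regular_term h).

Section Runs.
Context (cA Lf : R) (slv : @solver R E) (Mmax : R).
Context (hslv : solver_guarantee cA slv f Lf h).
Context (hMmax : 4 * L <= Mmax).

Let K0 := 8 * Num.sqrt (2 * `|cA * Lf|).
Let K1 := Num.sqrt Mmax.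

Lemma center_edom sigma xbar x : 0 < sigma -> edom h xbar -> edom h x ->
  edom h ((1 - (1 - sigma / (4 * sigma))) *: xbar + (1 - sigma / (4 * sigma)) *: x).
Proof.
move=> s0 hxbar hx.
have e4 : sigma / (4 * sigma) = 4^-1 by field; rewrite gt_eqF.
have -> : 1 - sigma / (4 * sigma) = 3 / 4 by rewrite e4; field.
rewrite addrC -{1}(subKr 1 (3 / 4)) subKr.
by have [] := edom_convex _ hreg x xbar (3 / 4) hx hxbar; [lra|].
Qed.

Lemma ar_l_exists sigma xbar xprev M : 0 < sigma -> edom h xbar -> edom h xprev ->
  0 < M <= Mmax -> exists xo vo Mo n, ar_l_from slv f h sigma xbar xprev M xo vo Mo n.
Proof.
move=> s0; have four1 : 1 < 4 :> R by lra.
have [i] := archi_expr 4 (Mmax / sigma) four1.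
rewrite ler_pdivrMr//; elim: i sigma s0 xbar xprev M => [|i IH] sigma s0 xbar xprev M.
all: move=> hi hxbar hxprev /andP[M0 Mle].
all: have [x [nA call]] := solver_call_exists _ _ _ hsm hreg _ _ _ hslv _ _ _ s0 hxbar hxprev.
all: have [xpp [xp [M' [nB bt]]]] := backtracking_exists _ h _ L0 hsm sigma x xbar M M0.
all: have [_ _ _ M'0 _] := backtracking_spec _ _ _ L0 hsm _ _ _ _ _ _ _ _ _ M0 Mle hMmax bt.
all: have [xs hxs] := prox_minimizer_exists _ _ _ hsm hreg sigma xbar s0.
all: have [hx _] := solver_call_accuracy _ _ _ hsm hreg _ _ _ hslv _ _ _ s0 hxbar hxprev _ _ _ call hxs.
  do 4!eexists; apply: ar_l_stop call bt _.
  by have /andP[_ M'le] := M'0; rewrite expr0 mul1r in hi; exact: le_trans M'le hi.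
have [M's|M's] := leP M' sigma; first by do 4!eexists; exact: ar_l_stop call bt M's.
have s40 : 0 < 4 * sigma by lra.
have hi4 : Mmax <= 4 ^+ i * (4 * sigma) by rewrite mulrA -exprSr.
have [xo [vo [Mo [n run]]]] :=
  IH _ s40 _ _ _ hi4 (center_edom _ _ _ s0 hxbar hx) hx M'0.
by exists xo, vo, Mo, (nA + nB + n)%N; exact: ar_l_next call bt M's run.
Qed.

(** The quantity bounded by [B] does not increase from a stage to the next one: by
    [regularization_drift] its new value is at most
    [sigma * (|xs - xbar| + 8 * |x - xs|)], and the solver ensures
    [8 * |x - xs| <= |xprev - xs|].
    For the cost, [1 / sqrt sigma] is halved at each stage.  A stage that is not the
    last one has [sigma < Mmax], so that its fixed part is at most a multiple of
    [K1 / sqrt sigma] and enters the same geometric series. *)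
Lemma ar_l_spec sigma xbar xprev M xo vo Mo n (B : R) :
  ar_l_from slv f h sigma xbar xprev M xo vo Mo n ->
  0 < sigma -> edom h xbar -> edom h xprev -> 0 < M <= Mmax ->
  (exists2 xs, is_minimizer (prox_objective f h sigma xbar) xs &
     sigma * (`|xs - xbar| + `|xprev - xs|) <= B) ->
  [/\ edom h xo, subdifferential h xo (vo - gradient f xo), `|vo| <= 3 / 2 * B,
      0 < Mo <= Mmax &
      exists2 j, Mo = 2 ^+ j * M &
        n%:R <= 4 + j%:R + 2 * (K0 + 4 * K1) / Num.sqrt sigma].
Proof.
move=> run; elim: run B =>
  {sigma xbar xprev M xo vo Mo n} [sigma xbar xprev M x xpp xp M' nA nB|
    sigma xbar xprev M x xpp xp M' nA nB xo vo Mo n].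
all: move=> call bt M's.
2: move=> run IH.
all: move=> B s0 hxbar hxprev /andP[M0 Mle] [xs hxs hB].
all: have r0 : 0 < Num.sqrt sigma by rewrite sqrtr_gt0.
all: have [_ exp acc M'0 [j nBE M'E]] := backtracking_spec _ _ _ L0 hsm _ _ _ _ _ _ _ _ _ M0 Mle hMmax bt.
all: have [hx hacc] := solver_call_accuracy _ _ _ hsm hreg _ _ _ hslv _ _ _ s0 hxbar hxprev _ _ _ call hxs.
all: have cost := solver_call_cost _ _ _ hsm hreg _ _ _ hslv _ _ _ s0 hxbar hxprev _ _ call.
all: have K00 : 0 <= K0 / Num.sqrt sigma by rewrite divr_ge0 ?mulr_ge0 ?sqrtr_ge0.
all: have K10 : 0 <= K1 / Num.sqrt sigma by rewrite divr_ge0 ?sqrtr_ge0.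
  have [M'0' _] := andP M'0.
  have M'01 : 0 < M' <= sigma by rewrite M'0'.
  have [hz hsub hv] := residual_bound _ _ _ hsm hreg _ _ _ _ _ _ s0 hxs hx (normr_ge0 _) hacc M'01 acc.
  rewrite exp; split=> //; first by rewrite (le_trans hv)//; lra.
  by exists j => //; rewrite nBE !natrD; move: cost K00 K10; rewrite -/K0; lra.
have s40 : 0 < 4 * sigma by lra.
have [xs' hxs'] := prox_minimizer_exists _ _ _ hsm hreg (4 * sigma) 
  ((1 - (1 - sigma / (4 * sigma))) *: xbar + (1 - sigma / (4 * sigma)) *: x) s40.
have drift := regularization_drift _ _ _ hsm hreg _ _ _ _ _ s0 hxs hxs'.
have near := prox_near _ _ _ hsm hreg _ _ _ _ _ s0 hxs hx (normr_ge0 _) hacc.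
have [|hxo hsub hv Mo0 [j' MoE hn]] := IH B s40 (center_edom _ _ _ s0 hxbar hx) hx M'0.
  exists xs' => //; apply: (le_trans drift); apply: le_trans hB.
  by rewrite (ler_pM2l s0); lra.
split=> //; exists (j' + j)%N; first by rewrite MoE M'E exprD mulrA.
have s4 : Num.sqrt (4 * sigma) = 2 * Num.sqrt sigma.
  by rewrite sqrtrM// (_ : 4 = 2 ^+ 2 :> R) ?sqrtr_sqr ?normr_nat//; ring.
have K11 : 1 <= K1 / Num.sqrt sigma.
  rewrite ler_pdivlMr// mul1r ler_wsqrtr//.
  by have /andP[_ M'le] := M'0; exact: le_trans (ltW M's) M'le.
have e2 : 2 * (K0 + 4 * K1) / (2 * Num.sqrt sigma) = K0 / Num.sqrt sigma + 4 * (K1 / Num.sqrt sigma).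
  by field; rewrite gt_eqF.
move: hn; rewrite s4 e2 => hn.
rewrite nBE !natrD; move: cost hn K00 K11; rewrite -/K0; lra.
Qed.


Section PenaltyFree.
Context (D Dmax eps : R).
Context (hD : forall x y, edom h x -> edom h y -> `|x - y| <= D).
Context (hDmax : D <= Dmax).
Context (eps0 : 0 < eps).

(** Both the center and the starting point are at distance at most [D] from the first
    regularized minimizer, which gives [|v| <= 3 * sigma_1 * D <= eps]. *)
Lemma ar_l_residual xprev M Dprev x v Mo n : 0 < Dprev -> edom h xprev -> 0 < M <= Mmax ->
  ar_l slv f h xprev (eps / (7 * (4 * Dprev))) M x v Mo n ->
  [/\ edom h x, subdifferential h x (v - gradient f x),
      D <= 4 * Dprev -> `|v| <= eps, 0 < Mo <= Mmax &
      exists2 j, Mo = 2 ^+ j * M &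
        n%:R <= 4 + j%:R + 2 * (K0 + 4 * K1) / Num.sqrt (eps / (7 * (4 * Dprev)))].
Proof.
move=> D0 hx hM run.
have [s sdef] : exists s, s = eps / (7 * (4 * Dprev)) by eexists.
have s0 : 0 < s by rewrite sdef divr_gt0// !mulr_gt0.
rewrite /ar_l -sdef in run *.
have [xs hxs] := prox_minimizer_exists _ _ _ hsm hreg s xprev s0.
have [hs _] := prox_minimizer_optimal _ _ _ hsm hreg _ _ s0 _ hxs.
have [|hxo hsub hv Mo0 hj] := ar_l_spec _ _ _ _ _ _ _ _ (2 * (s * D)) run s0 hx hx hM.
  exists xs => //; have := hD _ _ hs hx; have := hD _ _ hx hs => h1 h2.
  by have := ler_wpM2l (ltW s0) h1; have := ler_wpM2l (ltW s0) h2; lra.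
split=> // DD; apply: (le_trans hv).
have sE : eps = s * (7 * (4 * Dprev)) by rewrite sdef divfK// gt_eqF// !mulr_gt0.
have h1 := ler_wpM2l (ltW s0) DD; have h2 := mulr_gt0 s0 D0.
by rewrite [X in _ <= X]sE; lra.
Qed.

Lemma pf_ar_exists xprev M Dprev : 0 < Dprev -> edom h xprev -> 0 < M <= Mmax ->
  exists x v n, pf_ar slv f h xprev M Dprev eps x v n.
Proof.
move=> D0; have four1 : 1 < 4 :> R by lra.
have [i] := archi_expr 4 (D / (4 * Dprev)) four1.
rewrite ler_pdivrMr ?mulr_gt0//; elim: i xprev M Dprev D0 => [|i IH] xprev M Dprev D0 hi hx hM.
all: have s0 : 0 < eps / (7 * (4 * Dprev)) by rewrite divr_gt0// !mulr_gt0.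
all: have [x [v [Mo [n run]]]] := ar_l_exists _ _ _ _ s0 hx hx hM.
all: have [hxo _ hv Mo0 _] := ar_l_residual _ _ _ _ _ _ _ D0 hx hM run.
  by exists x, v, n; apply: pf_ar_stop run (hv _); move: hi; rewrite expr0; lra.
have [veps|veps] := leP `|v| eps; first by exists x, v, n; exact: pf_ar_stop run veps.
have D40 : 0 < 4 * Dprev by lra.
have hi' : D <= 4 ^+ i * (4 * (4 * Dprev)) by rewrite mulrA -exprSr.
have [xo [vo [n' run']]] := IH _ _ _ D40 hi' hxo Mo0.
by exists xo, vo, (n + n')%N; exact: pf_ar_next run veps run'.
Qed.

Definition pf_ar_round_cost := 4 + 2 * (K0 + 4 * K1) * Num.sqrt (28 * Dmax / eps).

(** Induction on the number [T] of rounds left before [4 * Dprev] reaches [D]; the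
    doublings [j] of all the rounds are bounded through the final estimate. *)
Lemma pf_ar_spec T xprev M Dprev x v n : 0 < Dprev <= Dmax -> edom h xprev ->
  0 < M <= Mmax -> D <= 4 ^+ T * (4 * Dprev) ->
  pf_ar slv f h xprev M Dprev eps x v n ->
  [/\ edom h x, subdifferential h x (v - gradient f x), `|v| <= eps &
      exists2 j, 2 ^+ j * M <= Mmax & n%:R <= j%:R + T.+1%:R * pf_ar_round_cost].
Proof.
elim: T xprev M Dprev x v n => [|T IH] xprev M Dprev x v n /andP[D0 DDmax] hx hM hT.
all: have cost1 : 2 * (K0 + 4 * K1) / Num.sqrt (eps / (7 * (4 * Dprev)))
   <= 2 * (K0 + 4 * K1) * Num.sqrt (28 * Dmax / eps).
1,3: rewrite ler_wpM2l ?mulr_ge0 ?addr_ge0 ?mulr_ge0 ?sqrtr_ge0//.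
1,2: rewrite -sqrtrV ?divr_ge0 ?mulr_ge0 ?(ltW eps0) ?(ltW D0)// ler_wsqrtr//.
1,2: by rewrite invf_div ler_wpM2r ?invr_ge0 ?(ltW eps0)//; lra.
all: move=> run; inversion run as [x1 M1 D1 x2 v2 Mo n1 arl veps|
  x1 M1 D1 x2 v2 Mo n1 xo vo n' arl veps run']; subst.
all: have [hxo hsub hv Mo0 [j MoE hn]] := ar_l_residual _ _ _ _ _ _ _ D0 hx hM arl.
- split=> //; exists j; first by rewrite -MoE; case/andP: Mo0.
  by rewrite mul1r /pf_ar_round_cost; lra.
- by move: veps; rewrite ltNge hv//; move: hT; rewrite expr0; lra.
- split=> //; exists j; first by rewrite -MoE; case/andP: Mo0.
  have c0 : 0 <= T.+1%:R * pf_ar_round_cost.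
    rewrite mulr_ge0// /pf_ar_round_cost addr_ge0// mulr_ge0 ?sqrtr_ge0//.
    by rewrite !(mulr_ge0, addr_ge0) ?sqrtr_ge0.
  by rewrite -(natr1 T.+1) mulrDl mul1r; rewrite {2}/pf_ar_round_cost; lra.
have Dprev4 : 0 < 4 * Dprev <= Dmax.
  rewrite mulr_gt0//=; have [DD|/ltW DD] := leP D (4 * Dprev); last exact: le_trans DD hDmax.
  by move: veps; rewrite ltNge hv.
have hT' : D <= 4 ^+ T * (4 * (4 * Dprev)) by rewrite mulrA -exprSr.
have [hxo' hsub' hv' [j' Mj' hn']] := IH _ _ _ _ _ _ Dprev4 hxo Mo0 hT' run'.
split=> //; exists (j' + j)%N; first by rewrite exprD -mulrA -MoE.
by rewrite -(natr1 T.+1) mulrDl mul1r {2}/pf_ar_round_cost !natrD; lra.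
Qed.

End PenaltyFree.

End Runs.

End Algorithms.

(** * The augmented Lagrangian and its multipliers *)

Section AugmentedLagrangian.
Context {R : realType} {E : euclideanType R} {m : nat}.
Context (A : {linear E -> 'cV[R]_m}) (b : 'cV[R]_m) (psis : E -> R).
Implicit Types (z u : E) (p q : 'cV[R]_m) (c : R).

(** Convexity at [u] bounds the remainder at [x] by
    [ip (gradient u - gradient x) (u - x)]. *)
Lemma lipschitz_gradient_smooth Lbar : convex_function setT psis ->
  (forall z, differentiable psis z) -> Lbar.-lipschitz (gradient psis) ->
  smooth_convex psis Lbar.
Proof.
move=> cvx diff lip x u.
have hl y z : `|gradient psis y - gradient psis z| <= Lbar * `|y - z|.
  exact: (lip (y, z) (conj I I)).
split; last exact: hl.
have h1 := convex_gradient_le psis x u cvx (diff x).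
have h2 := convex_gradient_le psis u x cvx (diff u).
have := hl u x; move: h1 h2; move: (gradient psis x) (gradient psis u) => gx gu.
move=> h1 h2 h3; rewrite subr_ge0 h1 /=.
have := cauchy_schwarz (gu - gx) (u - x); have := ler_wpM2r (normr_ge0 (u - x)) h3.
by move: h1 h2; rewrite !ipE expr2; lra.
Qed.

Lemma aug_lagrangian_expansion c p z u :
  let G := gradient psis z + adjoint A (p + c *: (A z - b)) in
  aug_lagrangian A b psis c p u - aug_lagrangian A b psis c p z - ip G (u - z)
  = psis u - psis z - ip (gradient psis z) (u - z) + c / 2 * norm2 (A (u - z)) ^+ 2.
Proof.
rewrite /= /aug_lagrangian ipDl (ipC (adjoint _ _)) -adjointP.
move: (gradient psis z) => gz.
have -> : A u - b = A z - b + A (u - z) by rewrite linearB [RHS]addrC addrA subrK.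
move: (A z - b) (A (u - z)) => r w.
rewrite !norm2_sqr !dotvE (dotvC w r) (dotvC w p); lra.
Qed.

Context (Lbar K : R).
Context (psis_smooth : smooth_convex psis Lbar).
Context (K0 : 0 <= K).
Context (A_bounded : forall z, norm2 (A z) <= K * `|z|).

Lemma norm2A_sqr z : norm2 (A z) ^+ 2 <= K ^+ 2 * `|z| ^+ 2.
Proof. by rewrite -exprMn ler_pXn2r ?nnegrE ?norm2_ge0 ?mulr_ge0. Qed.

Lemma aug_lagrangian_quadratic c p z u : 0 <= c ->
  let G := gradient psis z + adjoint A (p + c *: (A z - b)) in
  0 <= aug_lagrangian A b psis c p u - aug_lagrangian A b psis c p z - ip G (u - z)
    <= (Lbar + c * K ^+ 2) * `|u - z| ^+ 2.
Proof.
move=> c0 /=; rewrite aug_lagrangian_expansion.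
have [/andP[h1 h2] _] := psis_smooth z u.
have h3 := ler_wpM2l c0 (norm2A_sqr (u - z)).
have h4 : 0 <= c * norm2 (A (u - z)) ^+ 2 by rewrite mulr_ge0 ?sqr_ge0.
by apply/andP; split; [move: h1|move: h2]; lra.
Qed.

Lemma gradient_aug_lagrangian c p z : 0 <= c ->
  gradient (aug_lagrangian A b psis c p) z
    = gradient psis z + adjoint A (p + c *: (A z - b)).
Proof.
move=> c0; apply: (gradient_quadratic _ _ _ (Lbar + c * K ^+ 2)) => u.
by have /andP[h0 h1] := aug_lagrangian_quadratic c p z u c0; rewrite ger0_norm.
Qed.

Lemma aug_lagrangian_smooth c p : 0 <= c ->
  smooth_convex (aug_lagrangian A b psis c p) (Lbar + c * K ^+ 2).
Proof.
move=> c0 z u; rewrite !gradient_aug_lagrangian//; split.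
  exact: aug_lagrangian_quadratic.
have [_] := psis_smooth z u; move: (gradient psis z) (gradient psis u) => gz gu h1.
rewrite opprD addrACA -adjointB opprD addrACA subrr add0r -scalerBr.
rewrite opprD opprK addrACA (addrC (- b)) subrr addr0 -linearB adjointZ.
rewrite (le_trans (ler_normD _ _))// normrZ (ger0_norm c0) mulrDl lerD//.
rewrite -mulrA ler_wpM2l// expr2 -mulrA.
by rewrite (le_trans (adjoint_bounded _ _ K0 A_bounded _))// ler_wpM2l.
Qed.

End AugmentedLagrangian.

Section Multiplier.
Context {R : realType} {E : euclideanType R} {m : nat}.
Context (A : {linear E -> 'cV[R]_m}) (b : 'cV[R]_m) (h : E -> \bar R).
Context (zbar : E) (D delta kappa k S : R).
Context (hreg : regular_term h).
Context (hD : forall x y, edom h x -> edom h y -> `|x - y| <= D).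
Context (delta0 : 0 < delta).
Context (hball : forall u, `|u - zbar| <= delta -> edom h u).
Context (hlip : forall x y, edom h x -> edom h y -> fine (h x) - fine (h y) <= k * `|x - y|).
Context (k0 : 0 <= k).
Context (kappa0 : 0 < kappa).
Context (hkappa : forall z, kappa * norm2 (A z) <= `|adjoint A (A z)|).
Context (hAzbar : A zbar = b).

(** The subgradient inequality at the point of the ball around [zbar] in the direction
    of [g]. *)
Lemma subgradient_bounded z g : edom h z -> subdifferential h z g ->
  delta * `|g| <= k * D + ip g (z - zbar).
Proof.
move=> hz hg; pose u := zbar + (delta / `|g|) *: g.
have hub : `|u - zbar| <= delta.
  rewrite /u addrC addKr normrZ normrM normfV normr_id (gtr0_norm delta0).
  have [->|g0] := eqVneq `|g| 0; first by rewrite mulr0 ltW.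
  by rewrite divfK.
have hu := hball u hub.
have := subdifferential_le _ hreg _ _ _ hz hu hg.
have : ip g (u - z) = ip g (zbar - z) + delta * `|g|.
  rewrite /u addrAC [LHS]ipDr ipZr -ip_norm; congr (_ + _).
  have [->|g0] := eqVneq `|g| 0; first by rewrite expr2 !mulr0.
  by rewrite expr2 mulrA divfK.
have := hlip _ _ hu hz; have := ler_wpM2l k0 (hD _ _ hu hz).
by rewrite !ipE; lra.
Qed.

(** If the norm grows from [q'] to [q], then [dotv (A z - b) q >= 0] and the previous
    estimate bounds [g]; the equation for [r] then bounds the adjoint at [q], hence [q]
    itself because [q] lies in the range of [A].  Otherwise the bound on [q'] is kept. *)
Lemma multiplier_bound c z g s r q q' (rho B : R) : 0 < c ->
  edom h z -> subdifferential h z g -> r = s + g + adjoint A q ->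
  `|s| <= S -> `|r| <= rho -> (exists y, q = A y) -> q = q' + c *: (A z - b) ->
  ((k + rho + S) * D / delta + rho + S) / kappa <= B -> norm2 q' <= B -> norm2 q <= B.
Proof.
move=> c0 hz hg rE hs hr [y qy] qE hB hq'.
have [qq|qq] := leP (norm2 q) (norm2 q'); first exact: le_trans qq hq'.
apply: le_trans hB; rewrite ler_pdivlMr//.
have gE : g = r - s - adjoint A q by rewrite rE addrAC addrK addrC addKr.
have hzbar : edom h zbar by apply: hball; rewrite subrr normr0 ltW.
have hd : 0 <= dotv (A z - b) q.
  rewrite -(pmulr_rge0 _ c0) -dotvZl.
  have -> : c *: (A z - b) = q - q' by rewrite qE [RHS]addrC addKr.
  rewrite !dotvE -norm2_sqr expr2; have := dotv_le q' q.
  have := ler_wpM2r (norm2_ge0 q) (ltW qq); lra.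
have hrs : `|r - s| <= rho + S.
  by rewrite (le_trans (ler_normB _ _))// lerD.
have hip : ip g (z - zbar) <= (rho + S) * D.
  rewrite gE ipDl ipNl (ipC (adjoint _ _)) -adjointP (linearB A) hAzbar.
  have h1 := cauchy_schwarz (r - s) (z - zbar).
  have h2 : `|r - s| * `|z - zbar| <= (rho + S) * D by rewrite ler_pM// hD.
  by move: hd h1 h2; lra.
have hg1 : `|g| <= (k + rho + S) * D / delta.
  rewrite ler_pdivlMr// mulrC; have := subgradient_bounded _ _ hz hg; move: hip; lra.
have hA : `|adjoint A q| <= rho + S + `|g|.
  have -> : adjoint A q = (r - s) - g by rewrite gE opprB addrC subrK.
  by rewrite (le_trans (ler_normB _ _))// lerD.
have := hkappa y; rewrite -qy; move: hA hg1; lra.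
Qed.

End Multiplier.

(** * Cost of one call of PF-AR on an augmented Lagrangian *)

Section CallCost.
Context {R : realType}.

(** This is how the logarithmic number of doublings is absorbed into the main term. *)
Lemma exponent_le_sqrt j (y : R) : 2 ^+ j <= y -> j%:R <= 2 * Num.sqrt y.
Proof.
move=> jy; have j2 : j%:R ^+ 2 + 2 * j%:R + 3 <= 4 * 2 ^+ j :> R.
  elim: j {jy} => [|j IH]; first by rewrite expr0; lra.
  by rewrite (exprS 2 j) -(natr1 j); have := sqr_ge0 (j%:R : R); lra.
have y0 : 0 <= y by apply: le_trans jy; exact: exprn_ge0.
rewrite -(ler_pXn2r (ltn0Sn 1)) ?nnegrE ?mulr_ge0 ?sqrtr_ge0//.
by rewrite exprMn sqr_sqrtr//; have := ler0n R j; lra.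
Qed.

End CallCost.

Section Method.
Context {R : realType} {E : euclideanType R} {m : nat}.
Context (A : {linear E -> 'cV[R]_m}) (b : 'cV[R]_m) (psis : E -> R) (psin : E -> \bar R).
Context (cA Lbar K M0 D0 D c1 : R) (slv : @solver R E) (T : nat).
Context (hsm : smooth_convex psis Lbar).
Context (Lbar0 : 0 < Lbar).
Context (K0 : 0 <= K).
Context (hK : forall z, norm2 (A z) <= K * `|z|).
Context (hreg : regular_term psin).
Context (hslv : forall (c : R) (p : 'cV[R]_m), 0 < c ->
  solver_guarantee cA slv (aug_lagrangian A b psis c p) (Lbar + c * opnorm A ^+ 2) psin).
Context (M00 : 0 < M0).
Context (D00 : 0 < D0).
Context (c10 : 0 < c1).
Context (hD : forall x y, edom psin x -> edom psin y -> `|x - y| <= D).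
Context (hT : D <= 4 ^+ T * (4 * D0)).

Let mu := M0 / c1 + 4 * (Lbar / c1 + K ^+ 2).
Let nu := `|cA| * (Lbar / c1 + opnorm A ^+ 2).
Let Dmax := D0 + `|D|.

(** The bound on the cost of a call divided by [sqrt (c / rh)]: the doublings, then
    [T.+1] rounds.  Here [mu * c] and [nu * c] dominate the largest estimate [M] and
    the smoothness constant of the solver for every [c >= c1]. *)
Definition call_constant := 2 * Num.sqrt (mu / M0) + T.+1%:R *
  (4 / Num.sqrt c1 + 2 * (8 * Num.sqrt (2 * nu) + 4 * Num.sqrt mu) * Num.sqrt (28 * Dmax)).

Lemma mu_ge0 : 0 <= mu.
Proof.
rewrite /mu addr_ge0 ?mulr_ge0 ?addr_ge0 ?sqr_ge0 ?invr_ge0 ?(ltW M00) ?(ltW c10)//.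
by rewrite divr_ge0 ?(ltW c10) ?(ltW Lbar0).
Qed.

Lemma nu_ge0 : 0 <= nu.
Proof.
rewrite /nu mulr_ge0// addr_ge0 ?sqr_ge0//.
by rewrite divr_ge0 ?(ltW c10) ?(ltW Lbar0).
Qed.

Lemma call_constant_ge0 : 0 <= call_constant.
Proof.
by rewrite /call_constant !(addr_ge0, mulr_ge0) ?invr_ge0 ?sqrtr_ge0.
Qed.

Section Call.
Context (c eps rh : R) (p : 'cV[R]_m) (zprev : E).
Context (hc : c1 <= c).
Context (hrh : 0 < rh <= 1).
Context (heps : rh <= eps).
Context (hz : edom psin zprev).

Let f := aug_lagrangian A b psis c p.
Let L := Lbar + c * K ^+ 2.
Let Mmax := M0 + 4 * L.

Lemma penalty_gt0 : 0 < c. Proof. exact: lt_le_trans c10 hc. Qed.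

Lemma tolerance_gt0 : 0 < eps.
Proof. by have /andP[r0 _] := hrh; exact: lt_le_trans r0 heps. Qed.

Lemma smoothness_gt0 : 0 < L.
Proof. by rewrite /L ltr_pwDl// mulr_ge0 ?sqr_ge0// ltW// penalty_gt0. Qed.

Lemma call_smooth : smooth_convex f L.
Proof. by apply: aug_lagrangian_smooth => //; rewrite ltW// penalty_gt0. Qed.

Lemma initial_estimate_bounds : 0 < M0 <= Mmax.
Proof. by rewrite M00 /Mmax lerDl mulr_ge0// ltW// smoothness_gt0. Qed.

Lemma estimate_bound_ge : 4 * L <= Mmax.
Proof. by rewrite /Mmax lerDr ltW. Qed.

Lemma call_exists : exists z r n, pf_ar slv f psin zprev M0 D0 eps z r n.
Proof.
exact: (pf_ar_exists f psin L smoothness_gt0 call_smooth hreg cA _ slv Mmax (hslv _ _ penalty_gt0)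
  estimate_bound_ge D eps hD tolerance_gt0 zprev M0 D0 D00 hz initial_estimate_bounds).
Qed.

Lemma penalty_ratio_ge1 : 1 <= c / c1.
Proof. by rewrite ler_pdivlMr ?mul1r. Qed.

Lemma estimate_bound_le : Mmax <= mu * c.
Proof.
have r1 := penalty_ratio_ge1; rewrite /Mmax /mu /L.
have -> : (M0 / c1 + 4 * (Lbar / c1 + K ^+ 2)) * c
  = M0 * (c / c1) + 4 * (Lbar * (c / c1) + c * K ^+ 2) by ring.
have := ler_wpM2l (ltW M00) r1; have := ler_wpM2l (ltW Lbar0) r1; lra.
Qed.

Lemma solver_smoothness_le : `|cA * (Lbar + c * opnorm A ^+ 2)| <= nu * c.
Proof.
have r1 := penalty_ratio_ge1; rewrite normrM /nu -mulrA ler_wpM2l// ger0_norm.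
  have -> : (Lbar / c1 + opnorm A ^+ 2) * c = Lbar * (c / c1) + c * opnorm A ^+ 2 by ring.
  by rewrite lerD2r; have := ler_wpM2l (ltW Lbar0) r1; lra.
by rewrite addr_ge0 ?(ltW Lbar0)// mulr_ge0 ?sqr_ge0 ?(ltW penalty_gt0).
Qed.

Lemma call_spec z r n : pf_ar slv f psin zprev M0 D0 eps z r n ->
  [/\ edom psin z,
      exists2 g, subdifferential psin z g &
        r = gradient psis z + g + adjoint A (p + c *: (A z - b)),
      `|r| <= eps &
      n%:R <= call_constant * (Num.sqrt c / Num.sqrt rh)].
Proof.
move=> run.
have DDmax : D <= Dmax by rewrite /Dmax ler_wpDl ?(ltW D00)// ler_norm.
have D0max : 0 < D0 <= Dmax by rewrite D00 /Dmax lerDl normr_ge0.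
have [hzo hsub hr [j hj hn]] := pf_ar_spec f psin L smoothness_gt0 call_smooth hreg cA _ slv Mmax
  (hslv _ _ penalty_gt0) estimate_bound_ge D Dmax eps hD DDmax tolerance_gt0 T zprev M0 D0 z r n
  D0max hz initial_estimate_bounds hT run.
split=> //.
  exists (r - gradient f z) => //.
  rewrite (gradient_aug_lagrangian A b psis _ K hsm K0 hK) ?(ltW penalty_gt0)//.
  by rewrite [RHS]addrAC [RHS]addrC subrK.
apply: (le_trans hn).
have c0 := penalty_gt0; have /andP[r0 r1] := hrh.
have sc0 : 0 < Num.sqrt c by rewrite sqrtr_gt0.
have sr0 : 0 < Num.sqrt rh by rewrite sqrtr_gt0.
have sr1 : 1 <= (Num.sqrt rh)^-1.
  by rewrite invf_ge1// -sqrtr1 ler_wsqrtr.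
have hjc : j%:R <= 2 * Num.sqrt (mu / M0) * (Num.sqrt c / Num.sqrt rh).
  apply: (@le_trans _ _ (2 * Num.sqrt (mu / M0 * c))).
    apply: exponent_le_sqrt; rewrite mulrAC ler_pdivlMr//.
    exact: le_trans hj estimate_bound_le.
  rewrite sqrtrM ?divr_ge0 ?mu_ge0 ?(ltW M00)// !mulrA.
  by rewrite ler_peMr// !mulr_ge0 ?sqrtr_ge0.
have hround : pf_ar_round_cost cA (Lbar + c * opnorm A ^+ 2) Mmax Dmax eps
  <= (4 / Num.sqrt c1 + 2 * (8 * Num.sqrt (2 * nu) + 4 * Num.sqrt mu)
       * Num.sqrt (28 * Dmax)) * (Num.sqrt c / Num.sqrt rh).
  rewrite /pf_ar_round_cost [leRHS]mulrDl; apply: lerD.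
    have : 1 <= (Num.sqrt c1)^-1 * (Num.sqrt c / Num.sqrt rh).
      rewrite mulrA -(mul1r 1) ler_pM// mulrC ler_pdivlMr ?sqrtr_gt0// mul1r.
      by rewrite ler_wsqrtr.
    by rewrite -mulrA; lra.
  have Dm0 : 0 <= 28 * Dmax by rewrite mulr_ge0// /Dmax addr_ge0// ltW.
  have -> : 2 * (8 * Num.sqrt (2 * nu) + 4 * Num.sqrt mu) * Num.sqrt (28 * Dmax)
     * (Num.sqrt c / Num.sqrt rh)
    = (2 * (8 * (Num.sqrt (2 * nu) * Num.sqrt c) + 4 * (Num.sqrt mu * Num.sqrt c)))
      * (Num.sqrt (28 * Dmax) / Num.sqrt rh) by ring.
  apply: ler_pM; rewrite ?mulr_ge0 ?addr_ge0 ?mulr_ge0 ?sqrtr_ge0//.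
    have n1 : Num.sqrt (2 * `|cA * (Lbar + c * opnorm A ^+ 2)|)
        <= Num.sqrt (2 * nu) * Num.sqrt c.
      have nu2 : 0 <= 2 * nu by apply: mulr_ge0; rewrite ?nu_ge0.
      rewrite -(sqrtrM _ nu2) ler_wsqrtr//.
      by rewrite -mulrA ler_wpM2l// solver_smoothness_le.
    have n2 : Num.sqrt Mmax <= Num.sqrt mu * Num.sqrt c.
      by rewrite -(sqrtrM _ mu_ge0) ler_wsqrtr// estimate_bound_le.
    by move: n1 n2; lra.
  rewrite sqrtrM// ler_wpM2l ?sqrtr_ge0// sqrtrV ?(ltW tolerance_gt0)//.
  by rewrite lef_pV2 ?posrE ?sqrtr_gt0 ?tolerance_gt0// ler_wsqrtr.
rewrite /call_constant mulrDl; apply: lerD hjc _.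
by rewrite -[leRHS]mulrA ler_wpM2l.
Qed.

End Call.
End Method.

(** * The outer loop *)

Section OuterLoop.
Context {R : realType} {E : euclideanType R} {m : nat}.
Context (A : {linear E -> 'cV[R]_m}) (b : 'cV[R]_m) (psis : E -> R) (psin : E -> \bar R).
Context (slv : @solver R E) (M0 D0 alpha omega c1 et1 eh rh Q B : R) (p0 : 'cV[R]_m) (zbar : E).
Context (halpha : 1 < alpha).
Context (homega : 1 < omega).
Context (c10 : 0 < c1).
Context (eh0 : 0 < eh).
Context (rh01 : 0 < rh <= 1).
Context (rhet1 : rh <= et1).
Context (Q0 : 0 <= Q).
Context (B0 : 0 <= B).
Context (hAzbar : A zbar = b).
Context (call_ex : forall c eps (p : 'cV[R]_m) zprev,
  c1 <= c -> rh <= eps -> edom psin zprev ->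
  exists z r n, pf_ar slv (aug_lagrangian A b psis c p) psin zprev M0 D0 eps z r n).
Context (call_cost : forall c eps (p : 'cV[R]_m) zprev z r n,
  c1 <= c -> rh <= eps -> edom psin zprev ->
  pf_ar slv (aug_lagrangian A b psis c p) psin zprev M0 D0 eps z r n ->
  [/\ edom psin z,
      exists2 g, subdifferential psin z g &
        r = gradient psis z + g + adjoint A (p + c *: (A z - b)),
      `|r| <= eps &
      n%:R <= Q * (Num.sqrt c / Num.sqrt rh)]).
Context (multiplier_step : forall c z g r (q q' : 'cV[R]_m),
  c1 <= c -> edom psin z -> subdifferential psin z g ->
  r = gradient psis z + g + adjoint A (p0 + q) -> `|r| <= et1 ->
  (exists y, q = A y) -> q = q' + c *: (A z - b) -> norm2 q' <= B -> norm2 q <= B).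

Let feasible z := norm2 (A z - b) <= eh.
Let threshold := c1 + 2 * B / eh.
Let cmax := alpha ^+ 2 * threshold.
Let budget c := (Num.sqrt alpha * Num.sqrt cmax - Num.sqrt c) / (Num.sqrt alpha - 1).

(** The invariant at the beginning of an outer iteration.  Once [c] exceeds
    [threshold] every new iterate is feasible; the last component lets the penalty pass
    [alpha * threshold] only after a feasible iterate, that is, for the last call. *)
Definition ial_state (z : E) (p : 'cV[R]_m) (c et : R) :=
  [/\ edom psin z, (exists y, p - p0 = A y) /\ norm2 (p - p0) <= B,
      c1 <= c <= cmax, 0 <= et <= et1 &
      feasible z \/ c <= alpha * threshold].

Lemma sqrt_alpha_gt1 : 1 < Num.sqrt alpha.
Proof. by rewrite -sqrtr1 ltr_sqrt// (lt_trans _ halpha). Qed.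

Lemma growth_gt0 : 0 < alpha. Proof. exact: lt_trans halpha. Qed.

Lemma c1_le_threshold : c1 <= threshold.
Proof. by rewrite /threshold lerDl divr_ge0 ?(ltW eh0)// mulr_ge0. Qed.

(** [budget c] bounds the sum of the terms [sqrt (alpha ^+ k * c)] that are at most
    [sqrt cmax], in the closed form that makes it telescope along the iterations. *)
Lemma budget_last c : c <= cmax -> Num.sqrt c <= budget c.
Proof.
have a1 := sqrt_alpha_gt1; move=> cc; rewrite /budget ler_pdivlMr ?subr_gt0//.
rewrite mulrBr mulr1 lerB// mulrC ler_wpM2l ?sqrtr_ge0//.
by rewrite ler_wsqrtr.
Qed.

Lemma budget_step c : budget (alpha * c) + Num.sqrt c = budget c.
Proof.
have a1 := sqrt_alpha_gt1; rewrite /budget (sqrtrM _ (ltW growth_gt0)).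
by field; rewrite subr_eq0 gt_eqF.
Qed.

Lemma ial_tolerance_bounds z et : 0 <= et <= et1 ->
  rh <= ial_tolerance A b eh rh et z <= et1.
Proof.
move=> /andP[_ etle]; rewrite /ial_tolerance; case: ifP => _; last by rewrite lexx.
by rewrite le_max lexx orbT ge_max etle.
Qed.

Section Step.
Context (zprev : E) (p : 'cV[R]_m) (c et : R) (z r : E) (n : nat).
Context (st : ial_state zprev p c et).
Context (call : pf_ar slv (aug_lagrangian A b psis c p) psin
  zprev M0 D0 (ial_tolerance A b eh rh et zprev) z r n).

Let p' := p + c *: (A z - b).

Lemma step_facts : [/\ edom psin z,
    exists2 g, subdifferential psin z g & r = gradient psis z + g + adjoint A p',
    `|r| <= ial_tolerance A b eh rh et zprev,
    n%:R <= Q * (Num.sqrt c / Num.sqrt rh) &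
    ((exists y, p' - p0 = A y) /\ norm2 (p' - p0) <= B)].
Proof.
have [hz [[y py] pB] /andP[cc _] het _] := st.
have /andP[e1 e2] := ial_tolerance_bounds zprev et het.
have [hzo [g hg rE] hr hn] := call_cost _ _ _ _ _ _ _ cc e1 hz call.
have qE : p' - p0 = (p - p0) + c *: (A z - b) by rewrite /p' addrAC.
have qy : exists y, p' - p0 = A y.
  by exists (y + c *: (z - zbar)); rewrite qE linearD linearZ (linearB A) hAzbar py.
split=> //; [by exists g| split=> //].
apply: (multiplier_step _ _ _ _ _ _ cc hzo hg _ (le_trans hr e2) qy qE pB).
by rewrite (addrC p0) subrK.
Qed.

(** [c * (A z - b)] is the difference of two multipliers of norm at most [B]. *)
Lemma step_feasible : 2 * B <= c * eh -> feasible z.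
Proof.
have [_ _ _ _ [_ qB]] := step_facts; have [_ [_ pB] /andP[cc _] _ _] := st.
have c0 : 0 < c := lt_le_trans c10 cc.
move=> hc; rewrite /feasible -(ler_pM2l c0); apply: le_trans hc.
rewrite -(gtr0_norm c0) -norm2Z.
have -> : c *: (A z - b) = (p' - p0) - (p - p0).
  by rewrite opprB addrA subrK /p' addrC addKr.
rewrite (le_trans (norm2_triangle _ _))// norm2N; lra.
Qed.

(** After a feasible iterate the tolerance is [rh], so a call that does not end the run
    must have produced an infeasible point; by [step_feasible] its penalty is then at
    most [threshold]. *)
Lemma step_stuck : ~ ial_stop A b eh rh z r ->
  ial_state z p' (alpha * c) (et / omega).
Proof.
have [hzo _ hr _ hq] := step_facts.
have [_ _ /andP[cc cm] /andP[et0 etle] hcase] := st.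
have a0 := growth_gt0; have c0 : 0 < c := lt_le_trans c10 cc.
move=> stuck.
have hthr : ~ feasible z -> c <= threshold.
  move=> nf; rewrite leNgt; apply/negP => hlt; apply: nf; apply: step_feasible.
  have : 2 * B / eh <= c by apply: le_trans (ltW hlt); rewrite /threshold lerDr ltW.
  by rewrite ler_pdivrMr.
have hle : c <= alpha * threshold.
  case: hcase => // feas.
  have nf : ~ feasible z.
    move=> fz; apply: stuck; split=> //; move: hr; rewrite /ial_tolerance ltNge.
    by rewrite (feas : norm2 (A zprev - b) <= eh).
  rewrite (le_trans (hthr nf))// ler_peMl ?(ltW halpha)//.
  exact: le_trans (ltW c10) c1_le_threshold.
split=> //.
- rewrite /cmax expr2 -mulrA !ler_wpM2l ?(ltW a0)// andbT.
  by rewrite (le_trans cc)// ler_peMl ?(ltW halpha) ?(ltW c0).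
- have o0 : 0 < omega := lt_trans ltr01 homega.
  rewrite divr_ge0 ?(ltW o0)//= ler_pdivrMr// (le_trans etle)// ler_peMr ?(ltW homega)//.
  exact: le_trans et0 etle.
- have [fz|nf] := pselect (feasible z); [by left|right].
  by rewrite ler_wpM2l ?(ltW a0)// hthr.
Qed.

End Step.

(** Induction on a number [i] of iterations after which the penalty would exceed
    [cmax], against the invariant. *)
Lemma apf_ial_from_spec z p c et : ial_state z p c et ->
  (exists zo po ro n,
     apf_ial_from slv A b psis psin M0 D0 alpha omega eh rh z p c et zo po ro n) /\
  (forall zo po ro n,
     apf_ial_from slv A b psis psin M0 D0 alpha omega eh rh z p c et zo po ro n ->
     approx_solution A b psis psin eh rh zo po ro /\
     n%:R <= Q / Num.sqrt rh * budget c).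
Proof.
have rs0 : 0 < Num.sqrt rh by rewrite sqrtr_gt0; case/andP: rh01.
have cost_le x y : Q * (x / Num.sqrt rh) + Q / Num.sqrt rh * y = Q / Num.sqrt rh * (y + x).
  by field; rewrite gt_eqF.
have c0 : ial_state z p c et -> 0 < c.
  by case=> _ _ /andP[cc _] _ _; exact: lt_le_trans c10 cc.
have [i] := archi_expr alpha ((cmax + 1) / c) halpha.
elim: i z p c et c0 => [|i IH] z p c et c0 hi st; have {}c0 := c0 st.
  rewrite ler_pdivrMr// expr0 in hi.
  by have [_ _ /andP[_ cm] _ _] := st; exfalso; lra.
have [hz _ /andP[cc cm] het _] := st.
have /andP[e1 _] := ial_tolerance_bounds z et het.
have next z' r n : pf_ar slv (aug_lagrangian A b psis c p) psin
      z M0 D0 (ial_tolerance A b eh rh et z) z' r n -> ~ ial_stop A b eh rh z' r ->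
    let p' := p + c *: (A z' - b) in
    (exists zo po ro n', apf_ial_from slv A b psis psin M0 D0 alpha omega eh rh
       z' p' (alpha * c) (et / omega) zo po ro n') /\
    (forall zo po ro n', apf_ial_from slv A b psis psin M0 D0 alpha omega eh rh
       z' p' (alpha * c) (et / omega) zo po ro n' ->
     approx_solution A b psis psin eh rh zo po ro /\
     n'%:R <= Q / Num.sqrt rh * budget (alpha * c)).
  move=> call stuck p'; apply: IH => [_||]; last exact: step_stuck st call stuck.
    by rewrite mulr_gt0 ?growth_gt0.
  move: hi; rewrite !ler_pdivrMr ?mulr_gt0 ?growth_gt0//.
  by rewrite exprSr -mulrA.
split=> [|zo po ro n run].
  have [z' [r [n call]]] := call_ex c _ p z cc e1 hz.
  have [stop|stuck] := pselect (ial_stop A b eh rh z' r).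
    by do 4!eexists; exact: ial_done call stop.
  have [[zo [po [ro [n' run]]]] _] := next _ _ _ call stuck.
  by do 4!eexists; exact: ial_next call stuck run.
inversion run as [z1 p1 c2 et2 z2 r n1 call stop|
  z1 p1 c2 et2 z2 r n1 zo' po' ro' n' call stuck run']; subst.
all: have [_ [g hg rE] _ hn _] := step_facts _ _ _ _ _ _ _ st call.
  have [fz rr] := stop; split; first by split=> //; exists g.
  apply: (le_trans hn); rewrite mulrA mulrAC ler_wpM2l ?budget_last//.
  by rewrite divr_ge0// ltW.
have [_ spec] := next _ _ _ call stuck; have [sol hn'] := spec _ _ _ _ run'.
split=> //; rewrite natrD -(budget_step c) -cost_le; exact: lerD.
Qed.

End OuterLoop.

(** * Complexity of APF-IAL *)

Section DomainGeometry.
Context {R : realType} {E : euclideanType R}.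
Implicit Types (S : set E) (x y w : E).

Lemma diameter_ge S x y : compact S -> S x -> S y -> `|x - y| <= diameter S.
Proof.
move=> cS Sx Sy; apply: ub_le_sup; last by exists (x, y).
have [M M0 hM] := ex_strict_bound_gt0 (compact_bounded cS).
exists (M + M) => _ [[u v] [Su Sv] <-] /=.
by rewrite (le_trans (ler_normB _ _))// lerD// ltW//; exact: hM.
Qed.

(** The maximizer over a compact set of a nonzero linear form is a boundary point:
    the form still grows when one leaves it along its own gradient. *)
Lemma compact_boundary_nonempty S w : w != 0 -> compact S -> S !=set0 ->
  boundary S !=set0.
Proof.
move=> w0 cS S0.
have cont : {within S, continuous (ip w : E -> R)}.
  by apply: continuous_subspaceT; exact: ip_continuous.
have [y + ymax] := compact_EVT_max S0 cS cont.
rewrite inE => Sy; exists y; split; first exact: subset_closure.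
move=> /nbhs_normP[e /= e0 he].
have wp : 0 < `|w| by rewrite normr_gt0.
pose t := e / 2 / `|w|.
have t0 : 0 < t by rewrite !divr_gt0.
have Sz : S (y + t *: w).
  apply: he; rewrite /= opprD addrA subrr add0r normrN normrZ gtr0_norm//.
  by rewrite /t divfK ?gt_eqF// ltr_pdivrMr// ltr_pMr// ltrDl.
have := ymax (y + t *: w); rewrite inE => /(_ Sz).
rewrite ipDr ipZr gerDl leNgt mulr_gt0//.
by rewrite lt0r ip_eq0 w0 ip_ge0.
Qed.

Lemma dist_boundary_gt0 S x w : w != 0 -> compact S -> S° x ->
  0 < dist_set x (boundary S).
Proof.
move=> w0 cS hx; have Sx : S x := interior_subset hx.
have /nbhs_normP[e /= e0 he] := hx.
apply: (@lt_le_trans _ _ e) => //; apply: lb_le_inf.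
  have [y hy] := compact_boundary_nonempty S w w0 cS (ex_intro _ x Sx).
  by exists `|x - y|; exists y.
move=> _ [y [_ nint] <-]; rewrite leNgt; apply/negP => xy; apply: nint.
apply/nbhs_normP; exists (e - `|x - y|); first by rewrite /= subr_gt0.
move=> u /= yu; apply: he => /=.
by rewrite -(subrKA y) (le_lt_trans (ler_normD _ _))// addrC -ltrBrDr.
Qed.

End DomainGeometry.

Section Complexity.
Context {R : realType} {E : euclideanType R} {m : nat}.
Context (A : {linear E -> 'cV[R]_m}) (b : 'cV[R]_m) (psis : E -> R) (psin : E -> \bar R).
Context (Lbar cA : R) (slv : @solver R E) (z0 : E) (p0 : 'cV[R]_m).
Context (c1 alpha omega et1 M0 D0 Mn G delta : R) (zbar : E).
Context (hsm : smooth_convex psis Lbar).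
Context (Lbar0 : 0 < Lbar).
Context (hreg : regular_term psin).
Context (hslv : forall (c : R) (p : 'cV[R]_m), 0 < c ->
  solver_guarantee cA slv (aug_lagrangian A b psis c p) (Lbar + c * opnorm A ^+ 2) psin).
Context (hz0 : edom psin z0).
Context (c10 : 0 < c1).
Context (halpha : 1 < alpha).
Context (homega : 1 < omega).
Context (et10 : 0 < et1).
Context (M00 : 0 < M0).
Context (D00 : 0 < D0).
Context (hMn : forall x y, edom psin x -> edom psin y ->
  `|fine (psin x) - fine (psin y)| <= Mn * `|x - y|).
Context (Mn0 : 0 <= Mn).
Context (hG : forall z, edom psin z -> `|gradient psis z| <= G).
Context (delta0 : 0 < delta).
Context (hball : forall u, `|u - zbar| <= delta -> edom psin u).
Context (hAzbar : A zbar = b).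

(** All the constants are chosen before the tolerances; [eh] enters only through the
    largest penalty, which is at most [alpha ^+ 2 * (c1 + 2 * B) / eh] as [eh <= 1]. *)
Lemma apf_ial_complexity : exists2 C : R, 0 <= C & forall eh rh : R,
  0 < eh <= 1 -> 0 < rh <= 1 -> rh <= et1 ->
  let run := apf_ial slv A b psis psin M0 D0 alpha omega c1 et1 z0 p0 eh rh in
  (exists z p r N, run z p r N) /\
  (forall z p r N, run z p r N ->
     approx_solution A b psis psin eh rh z p r /\ N%:R <= C / Num.sqrt (eh * rh)).
Proof.
have [K K0 hK] := linear_norm2_bounded A.
have [kappa kappa0 hkappa] := adjoint_bounded_below A.
have [_ _ hcomp _] := hreg.
pose D := diameter (edom psin).
have hD x y : edom psin x -> edom psin y -> `|x - y| <= D by exact: diameter_ge.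
have four1 : 1 < 4 :> R by lra.
have [T] := archi_expr 4 (D / (4 * D0)) four1.
rewrite ler_pdivrMr ?mulr_gt0// => hT.
pose S := G + `|adjoint A p0|.
pose B := Num.max 0 (((Mn + et1 + S) * D / delta + et1 + S) / kappa).
have B0 : 0 <= B by rewrite /B le_max lexx.
pose Q := call_constant A cA Lbar K M0 D0 D c1 T.
have Q0 : 0 <= Q by exact: call_constant_ge0.
have a0 : 0 < alpha by exact: lt_trans halpha.
have sa1 : 1 < Num.sqrt alpha by rewrite -sqrtr1 ltr_sqrt.
pose C := 2 + Q * (Num.sqrt alpha * Num.sqrt (alpha ^+ 2 * (c1 + 2 * B)) / (Num.sqrt alpha - 1)).
exists C.
  rewrite /C addr_ge0// mulr_ge0// divr_ge0 ?mulr_ge0 ?sqrtr_ge0// subr_ge0.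
  exact: ltW.
move=> eh rh /andP[eh0 eh1] rh01 rhet run.
have /andP[rh0 rh1] := rh01.
have mstep c z g r (q q' : 'cV[R]_m) : c1 <= c -> edom psin z -> subdifferential psin z g ->
    r = gradient psis z + g + adjoint A (p0 + q) -> `|r| <= et1 ->
    (exists y, q = A y) -> q = q' + c *: (A z - b) -> norm2 q' <= B -> norm2 q <= B.
  move=> cc hz hg rE hr hy qE.
  apply: (multiplier_bound A b psin zbar D delta kappa Mn S hreg hD delta0 hball _ Mn0
    kappa0 hkappa hAzbar c z g (gradient psis z + adjoint A p0) r q q' et1) => //.
  - by move=> x y hx hy'; apply: le_trans (ler_norm _) _; exact: hMn.
  - exact: lt_le_trans c10 cc.
  - by rewrite rE adjointD addrA (addrAC _ g).
  - by rewrite (le_trans (ler_normD _ _))// lerD// hG.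
  - by rewrite /B le_max lexx orbT.
have [] := apf_ial_from_spec A b psis psin slv M0 D0 alpha omega c1 et1 eh rh Q B p0 zbar
  halpha homega c10 eh0 rh01 rhet Q0 B0 hAzbar _ _ mstep z0 p0 c1 et1.
- move=> c eps p zprev cc ee hz.
  exact: (call_exists A b psis psin cA Lbar K M0 D0 D c1 slv hsm Lbar0 (ltW K0) hK hreg hslv
    M00 D00 c10 hD c eps rh p zprev cc rh01 ee hz).
- move=> c eps p zprev z r n cc ee hz.
  exact: (call_spec A b psis psin cA Lbar K M0 D0 D c1 slv T hsm Lbar0 (ltW K0) hK hreg hslv
    M00 D00 c10 hD hT c eps rh p zprev cc rh01 ee hz).
- have thr : c1 <= c1 + 2 * B / eh by rewrite lerDl divr_ge0 ?(ltW eh0)// mulr_ge0.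
  have thr0 : 0 <= c1 + 2 * B / eh by exact: le_trans (ltW c10) thr.
  have t1 : c1 <= alpha * (c1 + 2 * B / eh).
    by rewrite (le_trans thr)// ler_peMl ?(ltW halpha).
  split=> //.
  + by split; [exists 0; rewrite subrr linear0|rewrite subrr norm20].
  + rewrite lexx /= (le_trans t1)// ler_wpM2r// expr2 ler_peMr ?(ltW halpha)//.
    exact: ltW.
  + by rewrite lexx (ltW et10).
  + by right.
move=> [z [p [r [n exrun]]]] spec; split.
  by exists z, p, r, (2 + n)%N, n.
move=> {z p r n exrun} z p r N [n -> hrun]; have [sol hn] := spec _ _ _ _ hrun.
split=> //; rewrite natrD.
have se0 : 0 < Num.sqrt eh by rewrite sqrtr_gt0.
have sr0 : 0 < Num.sqrt rh by rewrite sqrtr_gt0.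
have ser : 1 <= (Num.sqrt (eh * rh))^-1.
  rewrite invf_ge1 ?sqrtr_gt0 ?mulr_gt0// -sqrtr1 ler_wsqrtr// -(mulr1 1).
  by rewrite ler_pM// ltW.
rewrite /C mulrDl; apply: lerD; first by rewrite ler_peMr.
apply: (le_trans hn).
have cmax_le : Num.sqrt (alpha ^+ 2 * (c1 + 2 * B / eh))
    <= Num.sqrt (alpha ^+ 2 * (c1 + 2 * B)) / Num.sqrt eh.
  rewrite -sqrtrV ?(ltW eh0)// -sqrtrM; last first.
    by rewrite mulr_ge0 ?sqr_ge0// addr_ge0 ?mulr_ge0// ltW.
  rewrite ler_wsqrtr// -[leRHS]mulrA ler_wpM2l ?sqr_ge0// [leRHS]mulrDl lerD2r.
  by rewrite ler_peMr ?(ltW c10)// invf_ge1.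
have -> : Q * (Num.sqrt alpha * Num.sqrt (alpha ^+ 2 * (c1 + 2 * B)) / (Num.sqrt alpha - 1))
    / Num.sqrt (eh * rh)
  = Q / Num.sqrt rh * ((Num.sqrt alpha
      * (Num.sqrt (alpha ^+ 2 * (c1 + 2 * B)) / Num.sqrt eh)) / (Num.sqrt alpha - 1)).
  rewrite (sqrtrM _ (ltW eh0)); field.
  by rewrite !gt_eqF// subr_gt0.
rewrite ler_wpM2l ?divr_ge0 ?(ltW sr0)// ler_wpM2r ?invr_ge0 ?subr_ge0 ?(ltW sa1)//.
rewrite lerBlDr ler_wpDr ?sqrtr_ge0// ler_wpM2l ?sqrtr_ge0//.
Qed.

End Complexity.

Theorem theorem2p20 (R : realType) (E : euclideanType R) (m : nat)
    (A : {linear E -> 'cV[R]_m}) (b : 'cV[R]_m)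
    (psis : E -> R) (Lbar : R) (psin : E -> \bar R)
    (cA : R) (slv : @solver R E)
    (z0 w0 : E) (p0 : 'cV[R]_m) (c1 alpha omega et1 M0 D0 : R)
    (Mn : R) (zbar : E) (sA : R)
    (* the problem *)
    (hA : exists z, A z != 0)
    (hpsis_convex : convex_function setT psis)
    (hpsis_diff : forall z, differentiable psis z)
    (hLbar : 0 < Lbar)
    (hpsis_lip : Lbar.-lipschitz (gradient psis))
    (hpsin_proper : proper_efunction psin)
    (hpsin_closed : closed_efunction psin)
    (hpsin_convex : convex_efunction psin)
    (hpsin_compact : compact (edom psin))
    (* the inner solver, on the pairs generated by APF-IAL *)
    (hslv : forall (c : R) (p : 'cV[R]_m), 0 < c ->
       solver_guarantee cA slv (aug_lagrangian A b psis c p)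
         (Lbar + c * opnorm A ^+ 2) psin)
    (* the inputs of APF-IAL other than the tolerances *)
    (hz0 : edom psin z0) (hc1 : 0 < c1) (halpha : 1 < alpha)
    (homega : 1 < omega)
    (hinit : initial_estimates psis psin Lbar z0 w0 M0 D0)
    (* the assumptions of the theorem *)
    (hMn : Mn.-lipschitz_(edom psin) (fun z => fine (psin z)))
    (hzbar : (edom psin)° zbar) (hAzbar : A zbar = b)
    (hsA : smallest_positive_singular_value A sA) :
  let D := diameter (edom psin) in
  let dbar := dist_set zbar (boundary (edom psin)) in
  let nabla := sup [set `|gradient psis z| | z in edom psin] in
  let run := apf_ial slv A b psis psin M0 D0 alpha omega c1 et1 z0 p0 in
  (exists C : R, forall eh rh : R,
     0 < eh <= 1 -> 0 < rh <= 1 -> rh <= et1 ->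
     (exists z p r N, run eh rh z p r N) /\
     (forall z p r N, run eh rh z p r N ->
        approx_solution A b psis psin eh rh z p r /\
        N%:R <= C * (alpha `^ (3 / 2) * opnorm A * D
                       * Num.sqrt (Mn + nabla + et1)
                     / (Num.sqrt (dbar * sA) * (Num.sqrt alpha - 1)
                          * Num.sqrt (eh * rh))))) /\
  (exists C : R, forall eh : R,
     0 < eh <= 1 -> eh <= et1 ->
     (exists z p r N, run eh eh z p r N) /\
     (forall z p r N, run eh eh z p r N ->
        approx_solution A b psis psin eh eh z p r /\ N%:R <= C / eh)).
Proof.
move=> D dbar nabla run.
have hreg : regular_term psin by split=> //; exists Mn.
have hsm := lipschitz_gradient_smooth psis Lbar hpsis_convex hpsis_diff hpsis_lip.
have [hw0 w0z0 D0E hM] := hinit.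
have zw : 0 < `|z0 - w0| by rewrite normr_gt0 subr_eq0 eq_sym.
have D00 : 0 < D0 by rewrite D0E.
have M00 : 0 < M0.
  case: hM => [[gne ->]|[_ //]].
  by rewrite divr_gt0 ?mulr_gt0// normr_gt0 subr_eq0 eq_sym.
have hMn' x y : edom psin x -> edom psin y ->
    `|fine (psin x) - fine (psin y)| <= Mn * `|x - y|.
  by move=> hx hy; exact: (hMn (x, y) (conj hx hy)).
have Mn0 : 0 <= Mn.
  by rewrite -(pmulr_lge0 _ zw) (le_trans _ (hMn' _ _ hz0 hw0)).
have hD x y : edom psin x -> edom psin y -> `|x - y| <= D by exact: diameter_ge.
have D_gt0 : 0 < D by exact: lt_le_trans zw (hD _ _ hz0 hw0).
pose G := `|gradient psis z0| + Lbar * D.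
have hG z : edom psin z -> `|gradient psis z| <= G.
  move=> hz; rewrite -(subrK (gradient psis z0) (gradient psis z)) addrC.
  rewrite (le_trans (ler_normD _ _))// lerD2l.
  have [_ hl] := hsm z0 z; rewrite (le_trans hl)// ler_wpM2l ?(ltW hLbar)//.
  exact: hD.
have nabla0 : 0 <= nabla.
  apply: le_trans (normr_ge0 (gradient psis z0)) _; apply: ub_le_sup; last by exists z0.
  by exists G => _ [z hz <-]; exact: hG.
have dbar0 : 0 < dbar.
  apply: (dist_boundary_gt0 _ _ (z0 - w0)) => //.
  by rewrite subr_eq0 eq_sym.
have [sA0 _ _] := hsA.
have opn0 := opnorm_gt0 A hA.
have a0 : 0 < alpha by exact: lt_trans halpha.
have sa1 : 0 < Num.sqrt alpha - 1 by rewrite subr_gt0 -sqrtr1 ltr_sqrt.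
have /nbhs_normP[e /= e0 he] := hzbar.
have hball u : `|u - zbar| <= e / 2 -> edom psin u.
  move=> hu; apply: he; rewrite /= distrC (le_lt_trans hu)//.
  by rewrite ltr_pdivrMr// ltr_pMr// ltrDl.
have e20 : 0 < e / 2 by rewrite divr_gt0.
have [et10|et1n] := ltP 0 et1; last first.
  split; exists 0 => eh; [move=> rh _|]; move=> /andP[r0 _] re.
    by have := lt_le_trans r0 (le_trans re et1n); rewrite ltxx.
  by have := lt_le_trans r0 (le_trans re et1n); rewrite ltxx.
have [C C0 hC] := apf_ial_complexity A b psis psin Lbar cA slv z0 p0 c1 alpha omega et1 M0 D0
  Mn G (e / 2) zbar hsm hLbar hreg hslv hz0 hc1 halpha homega et10 M00 D00 hMn' Mn0 hG e20
  hball hAzbar.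
split.
  pose Y := alpha `^ (3 / 2) * opnorm A * D * Num.sqrt (Mn + nabla + et1)
    / (Num.sqrt (dbar * sA) * (Num.sqrt alpha - 1)).
  have Y0 : 0 < Y.
    rewrite /Y divr_gt0 ?mulr_gt0 ?powR_gt0 ?sqrtr_gt0 ?mulr_gt0//.
    by rewrite ltr_wpDl// addr_ge0.
  exists (C / Y) => eh rh heh hrh ret; have [ex spec] := hC _ _ heh hrh ret; split=> //.
  move=> z p r N hrun; have [sol hN] := spec _ _ _ _ hrun; split=> //.
  have split_div (x y s : R) : x / (y * s) = x / y / s by rewrite invfM mulrA.
  by rewrite [X in _ * X]split_div -/Y mulrA divfK ?gt_eqF.
exists C => eh heh ret; have [ex spec] := hC _ _ heh heh ret; split=> //.
move=> z p r N hrun; have [sol hN] := spec _ _ _ _ hrun; split=> //.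
have /andP[eh0 _] := heh.
by move: hN; rewrite -expr2 sqrtr_sqr gtr0_norm.
Qed.
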